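(* Let $X$ be a strictly convex real Banach space with the Radon-Nikodym property, $\dim X\ge 2$, and let $\Omega\subsetneq X$ be a nonempty convex open set. Then quasihyperbolic geodesics in $\Omega$ are unique: for any two points $x,y\in\Omega$ there is at most one quasihyperbolic geodesic joining $x$ to $y$ in $\Omega$, up to reparametrization. That is, if $\gamma_1,\gamma_2\colon[0,1]\to\Omega$ are quasihyperbolic geodesics from $x$ to $y$, each parametrized proportionally to quasihyperbolic length, then $\gamma_1=\gamma_2$.
   Context: A Banach space $X$ is strictly convex if $\|x+y\|<2$ whenever $\|x\|=\|y\|=1$ and $x\ne y$. $X$ has the Radon-Nikodym property (RNP) if every countably additive $X$-valued measure $\mu\colon\Sigma\to X$ on a $\sigma$-algebra $\Sigma$, of finite total variation $|\mu|$, can be written as $\mu(E)=\int_E\phi\,d|\mu|$ for all $E\in\Sigma$ with some Bochner integrable $X$-valued $\phi$; equivalently, every absolutely continuous path $\gamma\colon[0,1]\to X$ is differentiable almost everywhere. For an open path-connected $\Omega\subsetneq X$, the quasihyperbolic length of a rectifiable path $\gamma$ in $\Omega$ is $\ell_{\mathrm{qh}}(\gamma)=\int_\gamma \frac{ds}{\mathrm{dist}(\cdot,\partial\Omega)}$, where the integral is with respect to norm arc length and $\mathrm{dist}$ is the norm distance. The quasihyperbolic metric is $k_\Omega(x,y)=\inf_\gamma \ell_{\mathrm{qh}}(\gamma)$, the infimum over rectifiable paths in $\Omega$ joining $x$ and $y$. A quasihyperbolic geodesic joining $x$ and $y$ is a rectifiable path $\gamma$ in $\Omega$ from $x$ to $y$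 attaining this infimum. A path $\gamma\colon[0,1]\to\Omega$ is parametrized proportionally to quasihyperbolic length if $\ell_{\mathrm{qh}}(\gamma|_{[0,t]})=t\,\ell_{\mathrm{qh}}(\gamma)$ for all $t\in[0,1]$. *)

(* Defs.v *)
From mathcomp Require Import all_boot all_order all_algebra.
From mathcomp Require Import all_classical all_reals all_analysis.
Import Order.TTheory GRing.Theory Num.Theory.
Import numFieldNormedType.Exports.

Set Implicit Arguments.
Unset Strict Implicit.
Unset Printing Implicit Defensive.

Local Open Scope classical_set_scope.
Local Open Scope ring_scope.

Section BanachSpaces.
Context {R : realType}.

Definition strictly_convex (X : normedModType R) :=
  forall x y : X, `|x| = 1 -> `|y| = 1 -> x <> y -> `|x + y| < 2.

Definition dim_ge2 (X : normedModType R) :=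
  exists u v : X, forall a b : R, a *: u + b *: v = 0 -> a = 0 /\ b = 0.

Section VectorMeasures.
Context {X : normedModType R} {d : measure_display} {T : measurableType d}.

(* The values of [mu] on non-measurable sets are irrelevant.  Taking all [F i]
   empty shows that [mu set0 = 0]. *)
Definition vector_measure (mu : set T -> X) :=
  forall F : nat -> set T, (forall i, measurable (F i)) ->
    trivIset setT F ->
    (\sum_(0 <= i < n) mu (F i)) @[n --> \oo] --> mu (\bigcup_i F i).

(* |mu|(E): the supremum of the sums of `|mu (F i)| over the finite measurable
   partitions F 0, ..., F (n - 1) of E. *)
Definition vvariation (mu : set T -> X) (E : set T) : \bar R :=
  ereal_sup [set z : \bar R | exists n (F : nat -> set T),
    [/\ forall i, measurable (F i), trivIset `I_n F,
        \bigcup_(i in `I_n) F i = E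
      & z = (\sum_(i < n) `|mu (F i)|)%:E]].

(* The definitions below are meant for a finite measure [m].  It is a bare set
   function, as in the definition of the scalar integral, so that they can be
   applied to [vvariation mu]. *)
Implicit Type m : set T -> \bar R.

Definition simple_fun (s : T -> X) :=
  finite_set (range s) /\ forall v, measurable (s @^-1` [set v]).

Definition simple_integral m (E : set T) (s : T -> X) : X :=
  \sum_(v \in range s) fine (m (E `&` s @^-1` [set v])) *: v.

Definition strongly_measurable m (phi : T -> X) :=
  exists2 s : nat -> T -> X, (forall n, simple_fun (s n)) &
    m.-negligible (~` [set x | s n x @[n --> \oo] --> phi x]).

(* The function `|phi - s n| need only be measurable up to a null set; the
   library integral of a nonnegative function is the supremum of the integrals
   of its simple minorants, which null sets do not affect. *)
Definition bochner_approx m (phi : T -> X) (s : nat -> T -> X) :=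
  (forall n, simple_fun (s n)) /\
  (\int[m]_x `|phi x - s n x|%:E)%E @[n --> \oo] --> 0%E.

Definition bochner_integrable m (phi : T -> X) :=
  strongly_measurable m phi /\ exists s, bochner_approx m phi s.

(* For Bochner integrable [phi], the limit does not depend on [s]. *)
Definition is_bochner_integral m (E : set T) (phi : T -> X) (v : X) :=
  exists2 s, bochner_approx m phi s &
    simple_integral m E (s n) @[n --> \oo] --> v.

End VectorMeasures.

Definition radon_nikodym_property (X : normedModType R) :=
  forall (d : measure_display) (T : measurableType d) (mu : set T -> X),
    vector_measure mu -> (vvariation mu setT < +oo)%E ->
    exists2 phi : T -> X, bochner_integrable (vvariation mu) phi &
      forall E, measurable E ->
        is_bochner_integral (vvariation mu) E phi (mu E).

End BanachSpaces.

Section Quasihyperbolic.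
Context {R : realType} {X : normedModType R}.
Implicit Types (g : R -> X) (a b t l : R) (x y z : X) (A Omega : set X).

(* [total_variation], but for vector-valued functions. *)
Definition path_variation a b g (s : seq R) : R :=
  let F := g \o nth b (a :: s) in \sum_(0 <= n < size s) `|F n.+1 - F n|.

Definition path_length a b g : \bar R :=
  ereal_sup [set (path_variation a b g s)%:E | s in itv_partition a b].

(* The point of the path at arc length [l] from its origin [g a]: [g] is
   evaluated at the first parameter at which this length is reached. *)
Definition arclength_param a b g l : X :=
  g (inf [set t | (a <= t <= b) /\ (l%:E <= path_length a t g)%E]).

(* The integral of [f] with respect to arc length, for a path of finite
   length. *)
Definition line_integral a b g (f : X -> R) : \bar R :=
  (\int[lebesgue_measure]_(l in `[0%R, fine (path_length a b g)])
     (f (arclength_param a b g l))%:E)%E.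

Definition boundary A : set X := closure A `\` interior A.

Definition dist_set z A : R := inf [set `|z - y| | y in A].

Definition qh_length Omega a b g : \bar R :=
  line_integral a b g (fun z => (dist_set z (boundary Omega))^-1).

(* Paths are functions on R of which only the restriction to [0, 1] matters. *)
Definition rectifiable_path Omega x y g :=
  [/\ {within `[0, 1], continuous g},
      forall t, 0 <= t <= 1 -> Omega (g t),
      g 0 = x, g 1 = y
    & (path_length 0 1 g < +oo)%E].

Definition qh_dist Omega x y : \bar R :=
  ereal_inf [set qh_length Omega 0 1 g | g in rectifiable_path Omega x y].

Definition qh_geodesic Omega x y g :=
  rectifiable_path Omega x y g /\ qh_length Omega 0 1 g = qh_dist Omega x y.

Definition qh_proportional Omega g :=
  forall t, 0 <= t <= 1 ->
    qh_length Omega 0 t g = (t%:E * qh_length Omega 0 1 g)%E.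

End Quasihyperbolic.

(* Main.v *)
Require Import Defs.
From HB Require Import structures.
From mathcomp Require Import all_boot all_order all_algebra finmap.
From mathcomp Require Import all_classical all_reals all_analysis.
From mathcomp Require Import measurable_realfun ring lra.
Import Order.TTheory GRing.Theory Num.Theory.
Import numFieldNormedType.Exports.
Local Open Scope classical_set_scope.
Local Open Scope ring_scope.

(** Write [d z] for the distance from [z] to the boundary of [Omega].  Since
    [Omega] is convex, [d] is midpoint concave ([dist_midpoint]).  A geodesic [g]
    of quasihyperbolic length [L], parametrized proportionally, has norm speed
    [L * d (g t)] ([geodesic_metric_speed]).  Let [c] be the path of the midpoints of
    [g1 t] and [g2 (sigma t)], where [sigma] has slope [s] near [t].  Its speed
    is at most half the sum of the speeds of these two points and its distance
    to the boundary at least half the sum of their distances, so that the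
    density of its quasihyperbolic length is at most
[[
      L * (d (g1 t) + s * d (g2 (sigma t))) / (d (g1 t) + d (g2 (sigma t)))
]]
    ([midpath_qh_piece]); the total must be at least [L].

    With [sigma t = t] the bound is exactly [L], so no inequality can be strict.
    Perturbing [sigma] gives more.  A delay of [g2] gained on an interval and
    lost again on another one changes the total to first order by a multiple of
    the difference of the values of [d (g2 t) / (d (g1 t) + d (g2 t))] on the
    two intervals.  This ratio is [1 / 2] at the common origin, hence everywhere:
    [d (g1 t) = d (g2 t)] for all [t] ([dist_geodesics_le]).  Consequently [g1]
    and [g2] have the same length function, and their midpoint path has the same
    total length as well ([midpath_geodesics_length]).

    It remains to see that two paths with the same length function, whose
    midpoint path has full length, coincide.  Parametrized by arc length they
    become 1-Lipschitz curves [h1], [h2] on an interval.  A Lipschitz curve is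
    the primitive of a vector measure dominated by the Lebesgue measure
    ([lipschitz_measure]), which has a density by the Radon-Nikodym property.
    Full length of [h1 + h2] says that the sum of the two measures has variation
    twice the Lebesgue measure; this forces the densities to be of norm at most 1
    with a sum of norm 2 almost everywhere, hence to be equal by strict convexity
    ([densities_eq], [equal_vector_measures]). *)

Set Implicit Arguments.
Unset Strict Implicit.
Unset Printing Implicit Defensive.

(** * Distance to the boundary of a convex domain *)

Section ConvexDomain.
Context {R : realType} {X : normedModType R}.
Variable Omega : set X.
Hypothesis Omega_proper : Omega <> setT.
Hypothesis Omega_open : open Omega.
Implicit Types (z w y : X).

Local Notation d z := (dist_set z (boundary Omega)).

Lemma boundary_not_in y : boundary Omega y -> ~ Omega y.
Proof. by move=> [_]; rewrite (interior_id Omega).1. Qed.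

Lemma open_ball_sub z : Omega z -> exists2 e : R, 0 < e & forall w, `|z - w| < e -> Omega w.
Proof.
move=> zO; have : nbhs z Omega by exact: open_nbhs_nbhs.
move=> /nbhs_ballP[e e0 eO]; exists e => // w zw.
by apply: eO; rewrite -ball_normE.
Qed.

(** The supremum of the times at which the segment is in [Omega] gives a boundary
    point. *)
Lemma boundary_on_segment z w : Omega z -> ~ Omega w ->
  exists2 y, boundary Omega y & `|z - y| <= `|z - w|.
Proof.
move=> zO wO; pose p (t : R) := z + t *: (w - z).
pose S := [set t : R | 0 <= t <= 1 /\ Omega (p t)].
have S0 : S 0 by rewrite /S/= lexx ler01 /p scale0r addr0.
have S1 : ubound S 1 by move=> t [/andP[]].
have hS : has_sup S by split; [exists 0|exists 1].
pose c := sup S.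
have c0 : 0 <= c by apply: ub_le_sup => //; exists 1.
have c1 : c <= 1 by apply: ge_sup => //; exists 0.
have pD s t : `|p s - p t| = `|s - t| * `|w - z|.
  by rewrite /p opprD addrACA subrr add0r -scalerBl normrZ.
pose K := `|w - z| + 1.
have K0 : 0 < K by rewrite ltr_wpDl.
have pK s t e : `|s - t| < e / K -> `|p s - p t| < e.
  move=> st; have e0 : 0 < e / K by exact: le_lt_trans st.
  rewrite pD; apply: (@le_lt_trans _ _ (e / K * `|w - z|)).
    by rewrite ler_wpM2r// ltW.
  rewrite -[ltRHS](divfK (lt0r_neq0 K0)) ltr_pM2l//.
  by rewrite /K ltrDl.
exists (p c); last first.
  have := pD 0 c; rewrite /p scale0r addr0 => ->.
  by rewrite sub0r normrN ger0_norm// (distrC z) ler_piMl.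
split.
  move=> B /nbhs_ballP[e e0 eB].
  have [t St ct] := sup_adherent (divr_gt0 e0 K0) hS.
  exists (p t); split; first by case: St.
  apply: eB; rewrite -ball_normE /=; apply: pK.
  have tc : t <= c by apply: ub_le_sup => //; exists 1.
  by rewrite ger0_norm ?subr_ge0// ltrBlDl -ltrBlDr.
rewrite (interior_id Omega).1// => pcO.
have [e e0 eO] := open_ball_sub pcO.
have cn1 : c < 1.
  rewrite lt_neqAle c1 andbT; apply/eqP => cE; apply: wO.
  by move: pcO; rewrite /p cE scale1r addrC subrK.
pose t := Num.min 1 (c + e / K / 2).
have eK2 : 0 < e / K / 2 by rewrite !divr_gt0.
have ct : c < t by rewrite lt_min cn1 ltrDl.
have : S t.
  split; first by rewrite (le_trans c0 (ltW ct))//= ge_min lexx.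
  apply: eO; apply: pK; rewrite distrC gtr0_norm ?subr_gt0//.
  have : t <= c + e / K / 2 by rewrite ge_min lexx orbT.
  lra.
by move=> St; have := ub_le_sup (ex_intro _ 1 S1) St; rewrite leNgt ct.
Qed.

Lemma exists_not_in : exists w, ~ Omega w.
Proof.
apply: contrapT => H; apply: Omega_proper; apply/seteqP; split => // w _.
by apply: contrapT => wO; apply: H; exists w.
Qed.

Lemma dist_le z y : boundary Omega y -> d z <= `|z - y|.
Proof.
move=> yb; apply: ge_inf; last by exists y.
by exists 0 => _ [w _ <-].
Qed.

Hypothesis Omega_nonempty : Omega !=set0.

Lemma boundary_nonempty : boundary Omega !=set0.
Proof.
have [z zO] := Omega_nonempty; have [w wO] := exists_not_in.
by have [y yb _] := boundary_on_segment zO wO; exists y.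
Qed.

Lemma le_dist z (r : R) : (forall y, boundary Omega y -> r <= `|z - y|) -> r <= d z.
Proof.
move=> H; apply: lb_le_inf; first by have [y yb] := boundary_nonempty; exists `|z - y|, y.
by move=> _ [y yb <-]; exact: H.
Qed.

Lemma dist_lip z w : d z <= `|z - w| + d w.
Proof.
rewrite -lerBlDl; apply: le_dist => y yb; rewrite lerBlDl.
apply: le_trans (dist_le z yb) _.
by rewrite -(subrK w z) -addrA addrK ler_normD.
Qed.

Lemma dist_gt0 z : Omega z -> 0 < d z.
Proof.
move=> zO; have [e e0 eO] := open_ball_sub zO.
apply: (lt_le_trans e0); apply: le_dist => y yb; rewrite leNgt; apply/negP => zy.
by apply: (boundary_not_in yb); exact: eO.
Qed.

Lemma dist_ball_sub z w : Omega z -> `|z - w| < d z -> Omega w.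
Proof.
move=> zO zw; apply: contrapT => wO.
have [y yb yw] := boundary_on_segment zO wO.
by have := le_lt_trans (le_trans (dist_le z yb) yw) zw; rewrite ltxx.
Qed.

Hypothesis Omega_convex : convex_set (Omega : set (convex_lmodType X)).

Lemma convex_midpoint z w : Omega z -> Omega w -> Omega (2^-1 *: (z + w)).
Proof.
move=> zO wO.
have h01 : 0 <= (2^-1 : R) <= 1 by rewrite invr_ge0 ler0n/= invf_le1// ler1n.
pose p : {i01 R} := Itv01 (proj1 (andP h01)) (proj2 (andP h01)).
have := Omega_convex p (mem_set zO) (mem_set wO); rewrite inE.
rewrite /conv/=.
have -> : unstable.onem 2^-1 = 2^-1 :> R by rewrite /unstable.onem; lra.
by rewrite scalerDr.
Qed.

(** A boundary point [y] closer to the midpoint would be the midpoint of two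
    points of the balls with centers [z], [w] and radii [d z], [d w], which lie in
    [Omega]. *)
Lemma dist_midpoint z w : Omega z -> Omega w ->
  2^-1 * (d z + d w) <= d (2^-1 *: (z + w)).
Proof.
move=> zO wO; have dz := dist_gt0 zO; have dw := dist_gt0 wO.
set r := 2^-1 * _; have r0 : 0 < r by rewrite mulr_gt0// addr_gt0.
apply: le_dist => y yb; rewrite leNgt; apply/negP => yr.
apply: (boundary_not_in yb).
set v := 2^-1 *: (z + w) - y in yr.
have aux x (x0 : 0 < d x) : Omega x -> Omega (x - (d x / r) *: v).
  move=> xO; apply: (dist_ball_sub xO).
  rewrite opprB addrC subrK normrZ gtr0_norm ?divr_gt0//.
  by rewrite mulrAC ltr_pdivrMr// ltr_pM2l.
have := convex_midpoint (aux z dz zO) (aux w dw wO).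
rewrite addrACA scalerDr -opprD -scalerDl scalerN scalerA -mulrDl mulrA -/r.
by rewrite divff ?lt0r_neq0// scale1r /v opprB [X in Omega X]addrC subrK.
Qed.

End ConvexDomain.

(** * Length of paths *)

Section PathLength.
Context {R : realType} {X : normedModType R}.
Implicit Types (g : R -> X) (a b c t u v : R) (s : seq R).

Lemma path_variation_cons a b g c s :
  path_variation a b g (c :: s) = `|g c - g a| + path_variation c b g s.
Proof. by rewrite /path_variation big_nat_recl. Qed.

Lemma path_variation_nil a b g : path_variation a b g [::] = 0.
Proof. by rewrite /path_variation big_nil. Qed.

Lemma path_variation_cat a b c g s1 s2 : itv_partition a c s1 ->
  path_variation a b g (s1 ++ s2) =
  path_variation a c g s1 + path_variation c b g s2.
Proof.
elim: s1 a => [a /itv_partition_nil ->|x s1 IH a H] /=.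
  by rewrite path_variation_nil add0r.
by rewrite !path_variation_cons (IH _ (itv_partition_cons H)) addrA.
Qed.

Lemma path_variation_le a b g s : itv_partition a b s ->
  ((path_variation a b g s)%:E <= path_length a b g)%E.
Proof. by move=> abs; apply: ereal_sup_ubound; exists s. Qed.

Lemma norm_le_path_length a b g : a <= b -> (`|g b - g a|%:E <= path_length a b g)%E.
Proof.
rewrite le_eqVlt => /predU1P[->|ab].
  rewrite subrr normr0 -(path_variation_nil b b g).
  by apply: path_variation_le; split => /=.
have /path_variation_le := itv_partition1 ab.
by move=> /(_ g); rewrite path_variation_cons path_variation_nil addr0.
Qed.

Lemma path_length_ge0 a b g : a <= b -> (0 <= path_length a b g)%E.
Proof. by move=> ab; apply: le_trans _ (norm_le_path_length g ab). Qed.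

Lemma path_length_superadditive a b c g : a <= c -> c <= b ->
  (path_length a c g + path_length c b g <= path_length a b g)%E.
Proof.
move=> ac cb; have [->|fin] := eqVneq (path_length a b g) +oo%E; first by rewrite leey.
have ab := le_trans ac cb.
have {}fin : path_length a b g \is a fin_num.
  by rewrite ge0_fin_numE ?path_length_ge0// ltey.
have H s1 s2 : itv_partition a c s1 -> itv_partition c b s2 ->
   path_variation a c g s1 + path_variation c b g s2 <= fine (path_length a b g).
  move=> H1 H2; rewrite -lee_fin fineK// -(path_variation_cat _ _ _ H1).
  by apply: path_variation_le; exact: itv_partition_cat H1 H2.
have H2 s1 : itv_partition a c s1 ->
   ((path_variation a c g s1)%:E + path_length c b g <= path_length a b g)%E.
  move=> H1; rewrite -leeBrDl// -(fineK fin); apply: ge_ereal_sup => _ [s2 H2 <-].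
  by rewrite -EFinB lee_fin lerBrDl H.
have cfin : path_length c b g \is a fin_num.
  rewrite ge0_fin_numE ?path_length_ge0//.
  rewrite -(fineK fin) in H2.
  have [s1 ss1] : exists s, itv_partition a c s.
    move: ac; rewrite le_eqVlt => /predU1P[->|ac]; first by exists [::]; split => /=.
    by exists [:: c]; exact: itv_partition1.
  apply: le_lt_trans (ltry (fine (path_length a b g) - path_variation a c g s1)).
  by rewrite EFinB leeBrDl// H2.
rewrite -leeBrDr//; apply: ge_ereal_sup => _ [s1 H1 <-].
by rewrite leeBrDr// H2.
Qed.

(** A function [B] whose increments on [c, b] majorize those of [g] also
    majorizes the increments of the length of [g] there. *)
Lemma path_length_le_majorant a b c g (B : R -> R) : a <= c -> c <= b ->
  (forall u v, c <= u -> u <= v -> v <= b -> `|g v - g u| <= B v - B u) ->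
  (path_length a b g <= path_length a c g + (B b - B c)%:E)%E.
Proof.
move=> ac cb gB; apply: ge_ereal_sup => _ [s + <-].
elim: s a ac => [|x s IH] a ac abs.
  move: abs => /itv_partition_nil ab; have ca : c = a by lra.
  subst c; subst b; rewrite path_variation_nil subrr adde0.
  exact: path_length_ge0.
rewrite path_variation_cons.
have xb := itv_partition_le (itv_partition_cons abs).
have ax : a <= x by case: abs => /= /andP[/ltW].
(* [x] is the first point of the partition after [a]; if it lies beyond [c], the
   point [c] is inserted before it. *)
have [xc|cx] := leP x c.
  rewrite EFinD.
  apply: le_trans (leeD2l _ (IH x xc (itv_partition_cons abs))) _; rewrite addeA leeD2r//.
  apply: le_trans _ (path_length_superadditive g ax xc).
  by rewrite leeD2r// norm_le_path_length.
have H : path_variation x b g s <= B b - B x.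
  have : (forall u v, x <= u -> u <= v -> v <= b -> `|g v - g u| <= B v - B u).
    by move=> u v xu; apply: gB; rewrite (le_trans (ltW cx)).
  elim: s x xb {IH abs ax cx} (itv_partition_cons abs) => [|y s IH] x xb abs gBx.
    by rewrite path_variation_nil (itv_partition_nil abs) subrr.
  have yb := itv_partition_le (itv_partition_cons abs).
  have xy : x <= y by case: abs => /= /andP[/ltW].
  rewrite path_variation_cons; have := gBx x y (lexx _) xy yb.
  have := IH y yb (itv_partition_cons abs) (fun u v yu => gBx u v (le_trans xy yu)).
  lra.
apply: (@le_trans _ _ (`|g c - g a|%:E + (B b - B c)%:E))%E; last first.
  by rewrite leeD2r// norm_le_path_length.
rewrite -EFinD lee_fin; have := gB c x (lexx _) (ltW cx) xb.
have := ler_normD (g x - g c) (g c - g a); rewrite addrA subrK; lra.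
Qed.

Lemma path_lengthxx a g : path_length a a g = 0%E.
Proof.
apply/le_anti; rewrite path_length_ge0// andbT.
by apply: ge_ereal_sup => _ [s /itv_partitionxx -> <-]; rewrite path_variation_nil.
Qed.

Section Finite.
Variables (l : R) (g : R -> X).
Hypothesis g_fin : (path_length 0 l g < +oo)%E.

(** Length of [g] on [0, t]; a real number for [t] in [0, l]. *)
Definition arclength t : R := fine (path_length 0 t g).

Lemma path_length_fin t : 0 <= t <= l -> path_length 0 t g \is a fin_num.
Proof.
move=> /andP[t0 tl]; rewrite ge0_fin_numE ?path_length_ge0//.
apply: le_lt_trans g_fin; apply: le_trans _ (path_length_superadditive g t0 tl).
by rewrite leeDl// path_length_ge0.
Qed.

Lemma arclength0 : arclength 0 = 0.
Proof. by rewrite /arclength path_lengthxx. Qed.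

Lemma norm_le_arclength u v : 0 <= u -> u <= v -> v <= l ->
  `|g v - g u| <= arclength v - arclength u.
Proof.
move=> u0 uv vl; have v0 := le_trans u0 uv.
have ufin : path_length 0 u g \is a fin_num by rewrite path_length_fin// u0 (le_trans uv).
have vfin : path_length 0 v g \is a fin_num by rewrite path_length_fin// v0.
have := path_length_superadditive g u0 uv.
move=> /(le_trans (leeD2l _ (norm_le_path_length g uv))).
by rewrite -(fineK ufin) -(fineK vfin) -EFinD lee_fin lerBrDl.
Qed.

Lemma arclength_le u v : 0 <= u -> u <= v -> v <= l -> arclength u <= arclength v.
Proof.
by move=> u0 uv vl; rewrite -subr_ge0 (le_trans _ (norm_le_arclength u0 uv vl)).
Qed.

Lemma arclength_le_majorant u v (B : R -> R) : 0 <= u -> u <= v -> v <= l ->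
  (forall u v, 0 <= u -> u <= v -> v <= l -> `|g v - g u| <= B v - B u) ->
  arclength v - arclength u <= B v - B u.
Proof.
move=> u0 uv vl gB.
have ufin : path_length 0 u g \is a fin_num by rewrite path_length_fin// u0 (le_trans uv).
have vfin : path_length 0 v g \is a fin_num by rewrite path_length_fin// (le_trans u0).
have := path_length_le_majorant u0 uv
  (fun x y ux xy yv => gB x y (le_trans u0 ux) xy (le_trans yv vl)).
by rewrite -(fineK ufin) -(fineK vfin) -EFinD lee_fin lerBlDl.
Qed.

End Finite.

End PathLength.

(** * Line integrals along a path *)

Section LineIntegral.
Context {R : realType} {X : normedModType R}.
Variables (g : R -> X) (f : X -> R).
Hypothesis g_fin : (path_length 0 1 g < +oo)%E.
Hypothesis fg_cont : {within `[0, 1], continuous (f \o g)}.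
Hypothesis fg_ge0 : forall t, 0 <= t <= 1 -> 0 <= f (g t).
Implicit Types (a b t l : R).

Local Notation S := (arclength g).

(* [tau b l] is the infimum of the times up to [b] by which [g] has covered the
   length [l]: [g (tau b l)] is [arclength_param 0 b g l]. *)
Let A b l := [set t | (0 <= t <= b) /\ (l%:E <= path_length 0 t g)%E].
Let tau b l := inf (A b l).

Let A_lb b l : has_lbound (A b l).
Proof. by exists 0 => t [/andP[]]. Qed.

Let S_fin t : 0 <= t <= 1 -> path_length 0 t g = (S t)%:E.
Proof. by move=> t01; rewrite fineK// (path_length_fin g_fin). Qed.

Let A_end b l : 0 <= b <= 1 -> l <= S b -> A b l b.
Proof.
by move=> b01 lb; split; rewrite ?lexx ?andbT; [case/andP: b01|rewrite S_fin].
Qed.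

Let tau_itv b l : 0 <= b <= 1 -> l <= S b -> 0 <= tau b l <= b.
Proof.
move=> b01 lb; have Ab := A_end b01 lb.
rewrite ge_inf// andbT; apply: lb_le_inf; first by exists b.
by move=> t [/andP[]].
Qed.

Let tau_restrict a b l : 0 <= a -> a <= b -> b <= 1 -> l <= S a ->
  tau b l = tau a l.
Proof.
move=> a0 ab b1 la; have a01 : 0 <= a <= 1 by rewrite a0 (le_trans ab).
have b01 : 0 <= b <= 1 by rewrite b1 (le_trans a0).
have Aa := A_end a01 la; have /andP[_ ta] := tau_itv a01 la.
apply/le_anti/andP; split.
  apply: lb_le_inf; first by exists a.
  by move=> t [/andP[t0 tla] lt]; apply: ge_inf => //; split => //; rewrite t0 (le_trans tla).
apply: lb_le_inf; first by exists b; apply: A_end => //;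
  exact: le_trans la (arclength_le g_fin a0 ab b1).
move=> t [/andP[t0 tb] lt]; have [tla|/ltW ltt] := leP t a; last exact: le_trans ltt.
by apply: ge_inf => //; split => //; rewrite t0.
Qed.

Let tau_ge a b l : 0 <= a -> a <= b -> b <= 1 -> S a < l -> l <= S b -> a <= tau b l.
Proof.
move=> a0 ab b1 al lb; have b01 : 0 <= b <= 1 by rewrite b1 (le_trans a0).
apply: lb_le_inf; first by exists b; exact: A_end.
move=> t [/andP[t0 tb]]; have t01 : 0 <= t <= 1 by rewrite t0 (le_trans tb).
rewrite S_fin// lee_fin => lt; rewrite leNgt; apply/negP => ta.
have := arclength_le g_fin t0 (ltW ta) (le_trans ab b1); lra.
Qed.

Let tau_measurable b : 0 <= b <= 1 ->
  measurable_fun `[0, S b] (fun l => (f (g (tau b l)))%:E).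
Proof.
move=> b01; apply/measurable_EFinP.
(* Truncating [l] at [S b] makes the first time nondecreasing on the whole line. *)
apply: (eq_measurable_fun (fun l => (f \o g) (tau b (Num.min l (S b))))).
  move=> l; rewrite inE/= in_itv/= => /andP[_ lb]; congr (f (g (tau _ _))).
  by apply/min_idPl.
apply: (measurable_comp (F := (`[0%R, 1%R]%classic : set R)) (f := f \o g)
  (g := fun l => tau b (Num.min l (S b)))) => //.
- move=> _ [l _ <-] /=; rewrite in_itv/=.
  have mS : Num.min l (S b) <= S b by rewrite ge_min lexx orbT.
  have /andP[-> /le_trans-> //] := tau_itv b01 mS.
  by case/andP: b01.
- exact: subspace_continuous_measurable_fun.
apply: nondecreasing_measurable => // l1 l2 l12.
have m2 : Num.min l2 (S b) <= S b by rewrite ge_min lexx orbT.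
apply: lb_le_inf; first by exists b; exact: A_end.
move=> t [tb lt]; apply: ge_inf => //; split => //; apply: le_trans _ lt.
by rewrite lee_fin le_min !ge_min l12 lexx orbT.
Qed.

Let I b := (\int[lebesgue_measure]_(l in `[0%R, S b]) (f (g (tau b l)))%:E)%E.

Lemma line_integralE b : line_integral 0 b g f = I b.
Proof. by []. Qed.

Let S0 : S 0 = 0.
Proof. exact: arclength0. Qed.

Let S_ge0 b : 0 <= b <= 1 -> 0 <= S b.
Proof. by move=> /andP[b0 b1]; rewrite -S0; exact: (arclength_le g_fin). Qed.

(** On [a, b] the line integral grows by at least [mu] and at most [nu] times
    the length: the times of the arc length parameters in ]S a, S b] lie in
    [a, b]. *)
Lemma line_integral_increment a b (mu nu : R) : 0 <= a -> a <= b -> b <= 1 -> 0 <= mu ->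
  (forall t, a <= t <= b -> mu <= f (g t) <= nu) ->
  exists2 J : \bar R, line_integral 0 b g f = (line_integral 0 a g f + J)%E &
    ((mu * (S b - S a))%:E <= J <= (nu * (S b - S a))%:E)%E.
Proof.
move=> a0 ab b1 mu0 H; have a01 : 0 <= a <= 1 by rewrite a0 (le_trans ab).
have b01 : 0 <= b <= 1 by rewrite b1 (le_trans a0).
have Sab := arclength_le g_fin a0 ab b1; have Sa0 := S_ge0 a01.
have F0 l : l <= S b -> (0 <= (f (g (tau b l)))%:E)%E.
  move=> lb; rewrite lee_fin fg_ge0//.
  by have /andP[-> /le_trans->//] := tau_itv b01 lb.
have mb := tau_measurable b01.
have splitE : `[0, S b]%classic = `[0, S a]%classic `|` `]S a, S b]%classic :> set R.
  apply/seteqP; split => l /=; rewrite !in_itv/=.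
    by move=> /andP[l0 lb]; have [la|la] := leP l (S a); [left; rewrite l0|right].
  by move=> [/andP[-> la]|/andP[la ->]]; [rewrite (le_trans la)|rewrite (le_trans Sa0 (ltW la))].
exists (\int[lebesgue_measure]_(l in `]S a, S b]) (f (g (tau b l)))%:E)%E.
  rewrite !line_integralE /I splitE ge0_integral_setU//=.
  - congr (_ + _)%E; apply: eq_integral => l; rewrite inE/= in_itv/= => /andP[_ la].
    by rewrite (tau_restrict a0 ab b1).
  - by rewrite -splitE.
  - move=> l /= Hl; apply: F0; move: Hl; rewrite !in_itv/= => -[/andP[_]|/andP[]//].
    by move/le_trans; apply.
  - rewrite disj_set2E; apply/eqP/seteqP; split => // l /=; rewrite !in_itv/=.
    by move=> [/andP[_ la] /andP[al _]]; have := lt_le_trans al la; rewrite ltxx.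
have mab : measurable_fun (`]S a, S b]%classic : set R) (fun l => (f (g (tau b l)))%:E).
  by apply: measurable_funS mb => //; rewrite splitE; right.
have Hl l : (`]S a, S b]%classic : set R) l -> mu <= f (g (tau b l)) <= nu.
  rewrite /= in_itv/= => /andP[al lb]; apply: H.
  by rewrite (tau_ge a0 ab b1 al lb); have /andP[_ ->] := tau_itv b01 lb.
have len : lebesgue_measure (`]S a, S b]%classic : set R) = (S b - S a)%:E.
  rewrite lebesgue_measure_itv/= lte_fin; case: ltgtP Sab => // -> _.
  by rewrite subrr.
rewrite !EFinM -len -!(integral_cst lebesgue_measure)//; apply/andP; split.
  apply: ge0_le_integral => //.
  by move=> l /Hl /andP[]; rewrite lee_fin.
apply: ge0_le_integral => //.
- by move=> l; rewrite /= in_itv/= => /andP[_]; exact: F0.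
- by move=> l /Hl /andP[_]; rewrite lee_fin.
Qed.

Lemma line_integral0 : line_integral 0 0 g f = 0%E.
Proof.
by rewrite line_integralE /I S0 set_itv1 integral_set1.
Qed.

End LineIntegral.

(** * Real functions with controlled increments *)

Section RealAnalysis.
Context {R : realType}.

(** A function whose increments around each point are asymptotically at most
    [k] times those of the variable has global increments of this kind. *)
Lemma le_increment_local (f : R -> R) (al be k : R) : al <= be ->
  (forall t k', al <= t <= be -> k < k' -> exists2 de : R, 0 < de &
     forall a b, al <= a -> t - de < a -> a <= t -> t <= b -> b < t + de ->
       b <= be -> f b - f a <= k' * (b - a)) ->
  f be - f al <= k * (be - al).
Proof.
move=> ab loc; apply/ler_addgt0Pr => e e0.
pose k' := k + e / (be - al + 1).
have c0 : 0 < be - al + 1 by rewrite ltr_wpDl// subr_ge0.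
have kk' : k < k' by rewrite ltrDl divr_gt0.
apply: (@le_trans _ _ (k' * (be - al))); last first.
  rewrite /k' mulrDl lerD2l mulrAC ler_pdivrMr// ler_wpM2l ?(ltW e0)//.
  by rewrite ler_wpDr.
pose E := [set t | al <= t <= be /\ f t - f al <= k' * (t - al)].
have Eal : E al by rewrite /E/= lexx ab !subrr mulr0.
have Ebe : ubound E be by move=> t [/andP[]].
have hE : has_sup E by split; [exists al|exists be].
pose s := sup E.
have als : al <= s by apply: ub_le_sup => //; exists be.
have sbe : s <= be by apply: ge_sup => //; exists al.
have sE t : E t -> t <= s by apply: ub_le_sup; exists be.
have als_be : al <= s <= be by rewrite als.
have [de de0 H] := loc s k' als_be kk'.
have [a [/andP[ala abe] fa] sa] := sup_adherent de0 hE.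
have as_ : a <= s by apply: sE; split; rewrite ?ala.
(* Points on both sides of [s] are compared through [a <= s <= b]; this also shows
   that [s] itself belongs to [E]. *)
have Hb b : s <= b -> b < s + de -> b <= be -> E b.
  move=> sb bs bbe; split; first by rewrite bbe (le_trans als).
  by have := H a b ala sa as_ sb bs bbe; lra.
suff -> : be = s by have [] := Hb s (lexx _) (ltr_pwDr de0 (lexx _)) sbe.
apply/le_anti; rewrite sbe andbT leNgt; apply/negP => lt_s.
pose b := Num.min be (s + de / 2).
have de2 : 0 < de / 2 by rewrite divr_gt0.
have sb : s < b by rewrite lt_min lt_s ltrDl.
have bs : b <= s + de / 2 by rewrite ge_min lexx orbT.
have : E b by apply: Hb; rewrite ?(ltW sb) ?ge_min ?lexx//; lra.
by move=> /sE; rewrite leNgt sb.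
Qed.

Lemma lipschitz_within_continuous (X : normedModType R) (g : R -> X) (K : R) :
  (forall u v, 0 <= u -> u <= v -> v <= 1 -> `|g v - g u| <= K * (v - u)) ->
  {within `[0, 1], continuous g}.
Proof.
move=> gK; apply/subspace_continuousP => t; rewrite /= in_itv/= => /andP[t0 t1].
apply/cvgrPdist_lt => e e0; near_simpl.
have c0 : 0 < `|K| + 1 by rewrite ltr_wpDl.
exists (e / (`|K| + 1)) => /=; first by rewrite divr_gt0.
move=> s /= ts; rewrite in_itv/= => /andP[s0 s1].
have H : `|g t - g s| <= K * `|t - s|.
  have [st|/ltW ts'] := leP s t.
    by rewrite ger0_norm ?subr_ge0// gK.
  by rewrite distrC (distrC t) ger0_norm ?subr_ge0// gK.
apply: (le_lt_trans H); apply: (@le_lt_trans _ _ ((`|K| + 1) * `|t - s|)).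
  by rewrite ler_wpM2r// (le_trans (ler_norm _))// lerDl.
by rewrite mulrC -ltr_pdivlMr.
Qed.

End RealAnalysis.

(** * Quasihyperbolic length as a function of the parameter *)

Section QuasihyperbolicLength.
Context {R : realType} {X : normedModType R}.
Variable Omega : set X.
Hypothesis Omega_proper : Omega <> setT.
Hypothesis Omega_open : open Omega.
Hypothesis Omega_nonempty : Omega !=set0.
Variables (x y : X) (g : R -> X).
Hypothesis g_path : rectifiable_path Omega x y g.
Implicit Types (a b t : R).

Local Notation d z := (dist_set z (boundary Omega)).
Local Notation S := (arclength g).

(** Quasihyperbolic length of [g] on [0, t]; it is finite because [g] stays at
    a positive distance from the boundary. *)
Definition qh_param t : R := fine (qh_length Omega 0 t g).
Local Notation Q := qh_param.

Let g_cont : {within `[0, 1], continuous g}. Proof. by case: g_path. Qed.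
Let gO t : 0 <= t <= 1 -> Omega (g t). Proof. by case: g_path => _ + _ _ _; apply. Qed.
Let g_fin : (path_length 0 1 g < +oo)%E. Proof. by case: g_path. Qed.

Lemma dist_continuous : continuous (fun z : X => d z).
Proof.
move=> z; apply/cvgrPdist_lt => e e0; near=> w.
have zw : `|z - w| < e by near: w; exact: cvgr_dist_lt.
apply: le_lt_trans zw; rewrite ler_norml.
have := dist_lip Omega_proper Omega_open Omega_nonempty z w.
have := dist_lip Omega_proper Omega_open Omega_nonempty w z.
by rewrite (distrC w); lra.
Unshelve. all: by end_near. Qed.

Lemma dist_path_lower : exists2 m : R, 0 < m & forall t, 0 <= t <= 1 -> m <= d (g t).
Proof.
have dg : {within `[0, 1], continuous ((fun z => d z) \o g)}.
  apply/subspace_continuousP => t t01.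
  move/subspace_continuousP : g_cont => /(_ t t01) gt.
  exact: (cvg_comp _ _ gt (@dist_continuous (g t))).
have [t t01 H] := EVT_min ler01 dg.
exists (d (g t)); first by apply: dist_gt0 => //; apply: gO; move: t01; rewrite in_itv.
by move=> s s01; apply: H; rewrite in_itv.
Qed.

Lemma dist_path_upper t : 0 <= t <= 1 -> d (g t) <= d (g 0) + S 1.
Proof.
move=> /andP[t0 t1].
have := dist_lip Omega_proper Omega_open Omega_nonempty (g t) (g 0).
have := norm_le_arclength g_fin (lexx 0) t0 t1; rewrite arclength0.
have := arclength_le g_fin t0 t1 (lexx _); lra.
Qed.

Let wg_cont : {within `[0, 1], continuous ((fun z => (d z)^-1) \o g)}.
Proof.
apply/subspace_continuousP => t t01; apply: cvgV.
  by apply/lt0r_neq0/dist_gt0 => //; apply: gO; move: t01; rewrite /= in_itv.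
move/subspace_continuousP : g_cont => /(_ t t01) gt.
exact: (cvg_comp _ _ gt (@dist_continuous (g t))).
Qed.

Let wg_ge0 t : 0 <= t <= 1 -> 0 <= (d (g t))^-1.
Proof. by move=> t01; rewrite invr_ge0 ltW// dist_gt0//; exact: gO. Qed.

Lemma qh_length0 : qh_length Omega 0 0 g = 0%E.
Proof. exact: line_integral0. Qed.

Let increment a b (mu nu : R) : 0 <= a -> a <= b -> b <= 1 -> 0 < mu ->
  (forall t, a <= t <= b -> mu <= d (g t) <= nu) ->
  exists2 J : \bar R, qh_length Omega 0 b g = (qh_length Omega 0 a g + J)%E &
    ((nu^-1 * (S b - S a))%:E <= J <= (mu^-1 * (S b - S a))%:E)%E.
Proof.
move=> a0 ab b1 mu0 H; apply: line_integral_increment => //.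
  have /andP[H1 H2] : mu <= d (g a) <= nu by apply: H; rewrite lexx ab.
  by rewrite invr_ge0 (le_trans _ H2)// (le_trans (ltW mu0)).
move=> t tab; have /andP[H1 H2] := H t tab.
have dt : 0 < d (g t) by exact: lt_le_trans H1.
by rewrite !lef_pV2 ?posrE// ?H1 ?H2// (lt_le_trans dt).
Qed.

Lemma qh_length_fin t : 0 <= t <= 1 -> qh_length Omega 0 t g \is a fin_num.
Proof.
move=> /andP[t0 t1]; have [m m0 Hm] := dist_path_lower.
have [|J -> /andP[J1 J2]] := increment (lexx 0) t0 t1 m0 (nu := d (g 0) + S 1).
  move=> s /andP[s0 st]; have s01 : 0 <= s <= 1 by rewrite s0 (le_trans st).
  by rewrite Hm// dist_path_upper.
rewrite qh_length0 add0e fin_numE; apply/andP; split; apply/eqP => JE.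
  by move: J1; rewrite JE.
by move: J2; rewrite JE.
Qed.

Lemma qh_paramE t : 0 <= t <= 1 -> (Q t)%:E = qh_length Omega 0 t g.
Proof. by move=> t01; rewrite fineK// qh_length_fin. Qed.

Lemma qh_param0 : Q 0 = 0.
Proof. by rewrite /qh_param qh_length0. Qed.

Lemma qh_param_increment a b (mu nu : R) : 0 <= a -> a <= b -> b <= 1 -> 0 < mu ->
  (forall t, a <= t <= b -> mu <= d (g t) <= nu) ->
  nu^-1 * (S b - S a) <= Q b - Q a <= mu^-1 * (S b - S a).
Proof.
move=> a0 ab b1 mu0 H; have [J] := increment a0 ab b1 mu0 H.
have a01 : 0 <= a <= 1 by rewrite a0 (le_trans ab).
have b01 : 0 <= b <= 1 by rewrite b1 (le_trans a0).
rewrite -!qh_paramE//; case: J => // r; rewrite -EFinD => -[->].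
by rewrite !lee_fin addrAC subrr add0r.
Qed.

End QuasihyperbolicLength.

(** * Speed of a quasihyperbolic geodesic *)

Section MetricSpeed.
Context {R : realType} {X : normedModType R}.
Variable Omega : set X.
Hypothesis Omega_proper : Omega <> setT.
Hypothesis Omega_open : open Omega.
Hypothesis Omega_nonempty : Omega !=set0.
Implicit Types (x y : X) (g : R -> X) (a b t r : R).

Local Notation d z := (dist_set z (boundary Omega)).

(** The norm speed of [g] at [t] is [L * d (g t)], in integrated form, with
    error terms controlled by the constant [K]. *)
Definition metric_speed g (L K : R) := [/\ 0 <= L, 0 <= K,
  forall a b, 0 <= a -> a <= b -> b <= 1 ->
    arclength g b - arclength g a <= K * (b - a)
  & forall t a b r, 0 <= t <= 1 -> 0 <= r -> 0 <= a -> a <= b -> b <= 1 ->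
    t - r <= a -> b <= t + r ->
    (d (g t) - K * r) * L * (b - a) <= arclength g b - arclength g a
      <= (d (g t) + K * r) * L * (b - a)].

Lemma dist_path_lip g K a b : (path_length 0 1 g < +oo)%E ->
  (forall a b, 0 <= a -> a <= b -> b <= 1 ->
    arclength g b - arclength g a <= K * (b - a)) ->
  0 <= a <= 1 -> 0 <= b <= 1 -> `|d (g b) - d (g a)| <= K * `|b - a|.
Proof.
move=> g_fin HK; wlog ab : a b / a <= b => [H a01 b01|/andP[a0 a1] /andP[b0 b1]].
  have [ab|/ltW ba] := leP a b; first exact: H.
  by rewrite distrC (distrC b); exact: H.
have H := le_trans (norm_le_arclength g_fin a0 ab b1) (HK a b a0 ab b1).
rewrite (ger0_norm (x := b - a)) ?subr_ge0// ler_norml.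
have := dist_lip Omega_proper Omega_open Omega_nonempty (g b) (g a).
have := dist_lip Omega_proper Omega_open Omega_nonempty (g a) (g b).
by rewrite (distrC (g a)); lra.
Qed.

Lemma geodesic_metric_speed x y g : rectifiable_path Omega x y g ->
  qh_proportional Omega g ->
  exists K0 : R, forall K, K0 <= K -> metric_speed g (qh_param Omega g 1) K.
Proof.
move=> gP prop; set L := qh_param Omega g 1.
have g_fin : (path_length 0 1 g < +oo)%E by case: gP.
have gO t : 0 <= t <= 1 -> Omega (g t) by case: gP => _ + _ _ _; apply.
have i01 : 0 <= (1 : R) <= 1 by rewrite ler01 lexx.
have QE t : 0 <= t <= 1 -> qh_param Omega g t = t * L.
  move=> t01; have := prop t t01; have := qh_paramE Omega_proper Omega_open Omega_nonempty gP.
  by move=> QE; rewrite -!QE// -EFinM => -[].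
have inc a b (mu nu : R) : 0 <= a -> a <= b -> b <= 1 -> 0 < mu -> 
    (forall t, a <= t <= b -> mu <= d (g t) <= nu) ->
    mu * L * (b - a) <= arclength g b - arclength g a <= nu * L * (b - a).
  move=> a0 ab b1 mu0 H.
  have /andP[H1 H2] : mu <= d (g a) <= nu by apply: H; rewrite lexx ab.
  have nu0 : 0 < nu by exact: lt_le_trans mu0 (le_trans H1 H2).
  have := qh_param_increment Omega_proper Omega_open Omega_nonempty gP a0 ab b1 mu0 H.
  have a01 : 0 <= a <= 1 by rewrite a0 (le_trans ab).
  have b01 : 0 <= b <= 1 by rewrite b1 (le_trans a0).
  rewrite (QE a a01) (QE b b01) -mulrBl mulrC ler_pdivrMr// [_^-1 * _]mulrC.
  rewrite ler_pdivlMr// => /andP[I1 I2].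
  by apply/andP; split; lra.
have [m m0 Hm] := dist_path_lower Omega_proper Omega_open Omega_nonempty gP.
pose D := d (g 0) + arclength g 1.
have HD t : 0 <= t <= 1 -> m <= d (g t) <= D.
  by move=> t01; rewrite Hm// (dist_path_upper Omega_proper Omega_open Omega_nonempty gP).
have L0 : 0 <= L.
  have := qh_param_increment Omega_proper Omega_open Omega_nonempty gP
    (lexx 0) ler01 (lexx 1) m0 HD.
  rewrite qh_param0 subr0 => /andP[+ _]; apply: le_trans.
  rewrite mulr_ge0// ?subr_ge0 ?(arclength_le g_fin)// invr_ge0.
  by have /andP[H1 H2] := HD 1 i01; exact: (le_trans (ltW m0) (le_trans H1 H2)).
exists (D * L) => K DLK.
have K0 : 0 <= K.
  apply: le_trans DLK; rewrite mulr_ge0//.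
  by have /andP[H1 H2] := HD 1 i01; exact: (le_trans (ltW m0) (le_trans H1 H2)).
have HK a b : 0 <= a -> a <= b -> b <= 1 ->
    arclength g b - arclength g a <= K * (b - a).
  move=> a0 ab b1; have /andP[_ H] : m * L * (b - a) <= arclength g b - arclength g a <=
      D * L * (b - a).
    by apply: inc => // t /andP[at_ tb]; apply: HD; rewrite (le_trans a0)// (le_trans tb).
  by rewrite (le_trans H)// ler_wpM2r// subr_ge0.
split => // t a b r t01 r0 a0 ab b1 tra btr.
have near s : a <= s <= b -> d (g t) - K * r <= d (g s) <= d (g t) + K * r.
  move=> /andP[as_ sb]; have s01 : 0 <= s <= 1 by rewrite (le_trans a0)// (le_trans sb).
  have := dist_path_lip g_fin HK t01 s01.
  have : K * `|s - t| <= K * r by apply: ler_wpM2l => //; rewrite ler_norml; lra.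
  move=> H /le_trans/(_ H); rewrite ler_norml; lra.
(* When the lower bound for the distance is not positive it carries no information,
   and the positive bound [m] takes its place. *)
have [mu0|mu0] := ltP 0 (d (g t) - K * r); first exact: inc.
have Sab := arclength_le g_fin a0 ab b1.
apply/andP; split.
  apply: le_trans (_ : 0 <= _); last by rewrite subr_ge0.
  by rewrite -mulrA mulr_le0_ge0// mulr_ge0// subr_ge0.
suff /andP[] : m * L * (b - a) <= arclength g b - arclength g a <=
    (d (g t) + K * r) * L * (b - a) by [].
apply: inc => // s sab; have /andP[_ ->] := near s sab; rewrite andbT Hm//.
by case/andP: sab => as_ sb; rewrite (le_trans a0)// (le_trans sb).
Qed.

Lemma dist_path_bound x y g1 g2 : rectifiable_path Omega x y g1 ->
  rectifiable_path Omega x y g2 ->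
  exists M : R, forall t u, 0 <= t <= 1 -> 0 <= u <= 1 -> d (g1 t) + d (g2 u) <= 2 * M.
Proof.
move=> g1P g2P; exists (2^-1 * (d (g1 0) + arclength g1 1 + (d (g2 0) + arclength g2 1))).
move=> t u t01 u01; rewrite mulrA mulfV// mul1r.
have := dist_path_upper Omega_proper Omega_open Omega_nonempty g1P t01.
have := dist_path_upper Omega_proper Omega_open Omega_nonempty g2P u01; lra.
Qed.

Lemma dist_path_bound_gt0 x y g1 g2 M : rectifiable_path Omega x y g1 ->
  rectifiable_path Omega x y g2 ->
  (forall t u, 0 <= t <= 1 -> 0 <= u <= 1 -> d (g1 t) + d (g2 u) <= 2 * M) ->
  0 < M.
Proof.
move=> [_ g1O _ _ _] [_ g2O _ _ _] HM.
have i0 : 0 <= (0 : R) <= 1 by rewrite lexx ler01.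
have := HM 0 0 i0 i0.
have := dist_gt0 Omega_proper Omega_open Omega_nonempty (g1O 0 i0).
have := dist_gt0 Omega_proper Omega_open Omega_nonempty (g2O 0 i0); lra.
Qed.

End MetricSpeed.

(** * Midpoint paths *)

Lemma scaler_half (R : numFieldType) (V : lmodType R) (v : V) :
  2^-1 *: (v + v) = v.
Proof.
rewrite -[in LHS](scale1r v) -scalerDl scalerA.
by rewrite (_ : 1 + 1 = 2%:R) ?mulVf ?scale1r// pnatr_eq0.
Qed.

Section MidpointPath.
Context {R : realType} {X : normedModType R}.
Variable Omega : set X.
Hypothesis Omega_proper : Omega <> setT.
Hypothesis Omega_open : open Omega.
Hypothesis Omega_nonempty : Omega !=set0.
Hypothesis Omega_convex : convex_set (Omega : set (convex_lmodType X)).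

Local Notation d z := (dist_set z (boundary Omega)).

Variables (x y : X) (g1 g2 : R -> X) (L K : R).
Hypothesis (g1P : rectifiable_path Omega x y g1) (g2P : rectifiable_path Omega x y g2).
Hypothesis (g1_speed : metric_speed Omega g1 L K).
Hypothesis (g2_speed : metric_speed Omega g2 L K).

Variable sigma : R -> R.
Hypothesis (sigma0 : sigma 0 = 0) (sigma1 : sigma 1 = 1).
Hypothesis sigma_mono : forall a b, 0 <= a -> a <= b -> b <= 1 ->
  0 <= sigma b - sigma a <= 2 * (b - a).

(** The path of midpoints of corresponding points of [g1] and [g2], the latter
    being reparametrized by [sigma]. *)
Definition midpath t : X := 2^-1 *: (g1 t + g2 (sigma t)).
Local Notation c := midpath.

(** Half the sum of the lengths of the two arcs followed up to time [t]; its
    increments majorize the lengths of the arcs of the midpoint path. *)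
Definition midpath_majorant t : R :=
  2^-1 * (arclength g1 t + arclength g2 (sigma t)).
Local Notation B := midpath_majorant.

Let g1_fin : (path_length 0 1 g1 < +oo)%E. Proof. by case: g1P. Qed.
Let g2_fin : (path_length 0 1 g2 < +oo)%E. Proof. by case: g2P. Qed.
Let g1O t : 0 <= t <= 1 -> Omega (g1 t). Proof. by case: g1P => _ + _ _ _; apply. Qed.
Let g2O t : 0 <= t <= 1 -> Omega (g2 t). Proof. by case: g2P => _ + _ _ _; apply. Qed.
Let L0 : 0 <= L. Proof. by case: g1_speed. Qed.
Let K0 : 0 <= K. Proof. by case: g1_speed. Qed.

Let sigma01 t : 0 <= t <= 1 -> 0 <= sigma t <= 1.
Proof.
move=> /andP[t0 t1]; have := sigma_mono (lexx 0) t0 t1.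
by have := sigma_mono t0 t1 (lexx 1); rewrite sigma0 sigma1; lra.
Qed.

Lemma midpath_le_majorant a b : 0 <= a -> a <= b -> b <= 1 ->
  `|c b - c a| <= B b - B a.
Proof.
move=> a0 ab b1; rewrite -scalerBr normrZ ger0_norm ?invr_ge0// -mulrBr.
rewrite ler_wpM2l ?invr_ge0// opprD addrACA.
have /andP[sa0 _] : 0 <= sigma a <= 1 by rewrite sigma01// a0 (le_trans ab).
have /andP[_ sb1] : 0 <= sigma b <= 1 by rewrite sigma01// b1 (le_trans a0).
have sab : sigma a <= sigma b by have := sigma_mono a0 ab b1; lra.
apply: le_trans (ler_normD _ _) _.
have := norm_le_arclength g1_fin a0 ab b1.
have := norm_le_arclength g2_fin sa0 sab sb1; lra.
Qed.

Lemma midpath_in t : 0 <= t <= 1 -> Omega (c t).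
Proof.
by move=> t01; apply: convex_midpoint => //; [exact: g1O|exact/g2O/sigma01].
Qed.

Lemma midpath_rectifiable : rectifiable_path Omega x y c.
Proof.
split.
- apply: (lipschitz_within_continuous (K := 2 * K)) => a b a0 ab b1.
  apply: le_trans (midpath_le_majorant a0 ab b1) _.
  have /andP[sa0 _] : 0 <= sigma a <= 1 by rewrite sigma01// a0 (le_trans ab).
  have /andP[_ sb1] : 0 <= sigma b <= 1 by rewrite sigma01// b1 (le_trans a0).
  have /andP[sab sab2] := sigma_mono a0 ab b1; rewrite subr_ge0 in sab.
  have [_ _ H1 _] := g1_speed; have [_ _ H2 _] := g2_speed.
  have := H1 a b a0 ab b1; have := H2 _ _ sa0 sab sb1.
  have : K * (sigma b - sigma a) <= K * (2 * (b - a)) by rewrite ler_wpM2l.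
  have : 0 <= K * (b - a) by rewrite mulr_ge0// subr_ge0.
  rewrite /B; lra.
- exact: midpath_in.
- case: g1P => _ _ H _ _; case: g2P => _ _ H' _ _.
  by rewrite /midpath sigma0 H H' scaler_half.
- case: g1P => _ _ _ H _; case: g2P => _ _ _ H' _.
  by rewrite /midpath sigma1 H H' scaler_half.
- apply: le_lt_trans (ltry (B 1 - B 0)).
  have := path_length_le_majorant (lexx 0) ler01 midpath_le_majorant.
  by rewrite path_lengthxx add0e.
Qed.

Let c_fin : (path_length 0 1 c < +oo)%E. Proof. by case: midpath_rectifiable. Qed.

Lemma arclength_midpath_le a b : 0 <= a -> a <= b -> b <= 1 ->
  arclength c b - arclength c a <= B b - B a.
Proof.
by move=> a0 ab b1; apply: (arclength_le_majorant c_fin a0 ab b1); exact: midpath_le_majorant.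
Qed.

Variable M : R.
Hypothesis M_ge : forall t u, 0 <= t <= 1 -> 0 <= u <= 1 -> d (g1 t) + d (g2 u) <= 2 * M.

Let M_gt0 : 0 < M.
Proof. exact: (dist_path_bound_gt0 Omega_proper Omega_open Omega_nonempty g1P g2P M_ge). Qed.

(** Where [sigma] has slope [s], the density of the quasihyperbolic length of
    the midpoint path is at most [L * ka]; a loss of norm length of the midpoint
    path relative to its majorant makes it smaller still. *)
Lemma midpath_qh_piece (al be s ka : R) : 0 <= al -> al <= be -> be <= 1 ->
  0 <= s <= 2 -> 0 <= ka ->
  (forall a b, al <= a -> a <= b -> b <= be -> sigma b - sigma a = s * (b - a)) ->
  (forall t, al <= t <= be ->
    d (g1 t) + s * d (g2 (sigma t)) <= ka * (d (g1 t) + d (g2 (sigma t)))) ->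
  let f t := qh_param Omega c t + M^-1 * (B t - arclength c t) in
  f be - f al <= L * ka * (be - al).
Proof.
move=> al0 albe be1 /andP[s0 s2] ka0 sig_s Hka; set f := (fun t => _); rewrite -/f.
apply: le_increment_local => // t k' /andP[alt tbe] Lk.
have t01 : 0 <= t <= 1 by rewrite (le_trans al0)// (le_trans tbe).
have st01 := sigma01 t01.
set D := 2^-1 * (d (g1 t) + d (g2 (sigma t))).
have d1 := dist_gt0 Omega_proper Omega_open Omega_nonempty (g1O t01).
have d2 := dist_gt0 Omega_proper Omega_open Omega_nonempty (g2O st01).
have D0 : 0 < D by rewrite /D; lra.
have Lka0 : 0 <= L * ka by rewrite mulr_ge0.
have k'0 : 0 < k' by exact: le_lt_trans Lk.
have L0_ := L0; have K0_ := K0.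
have den0 : 0 < 2 * L + k' + 1 by lra.
(* [eta] bounds the errors on the distances to the boundary; it is chosen so that
   [L * (ka * D + 2 * eta) <= k' * (D - eta)]. *)
pose eta := (k' - L * ka) * D / (2 * L + k' + 1).
have eta0 : 0 < eta by rewrite divr_gt0// mulr_gt0// subr_gt0.
have etaE : eta * (2 * L + k' + 1) = (k' - L * ka) * D by rewrite divfK// lt0r_neq0.
have etaD : eta < D by rewrite ltr_pdivrMr// mulrC ltr_pM2l//; lra.
have K1 : 0 < 2 * K + 1 by lra.
(* At distance at most [de] from [t], the value of [sigma] changes by at most
   [2 * de], whence the factor 2 before [K]. *)
pose de := eta / (2 * K + 1).
have de0 : 0 < de by rewrite divr_gt0.
have deE : de * (2 * K + 1) = eta by rewrite divfK// lt0r_neq0.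
have Kde : 2 * K * de <= eta by lra.
have Kde0 : 0 <= K * de by rewrite mulr_ge0// ltW.
exists de => // a b ala ta at_ tb bt bbe.
have a0 := le_trans al0 ala; have ab := le_trans at_ tb; have b1 := le_trans bbe be1.
have a01 : 0 <= a <= 1 by rewrite a0 (le_trans ab).
have b01 : 0 <= b <= 1 by rewrite b1 (le_trans a0).
have /andP[sa0 _] := sigma01 a01; have /andP[_ sb1] := sigma01 b01.
have sab : sigma b - sigma a = s * (b - a) by exact: sig_s.
have ba0 : 0 <= b - a by lra.
have [_ _ lip1 loc1] := g1_speed; have [_ _ lip2 loc2] := g2_speed.
have sa2 := sigma_mono a0 at_ (le_trans tb b1).
have sb2 := sigma_mono (le_trans a0 at_) tb b1.
have tra : t - de <= a by lra.
have btr : b <= t + de by lra.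
have /andP[_ H1] := loc1 t a b de t01 (ltW de0) a0 ab b1 tra btr.
have stra : sigma t - 2 * de <= sigma a by lra.
have sbtr : sigma b <= sigma t + 2 * de by lra.
have sab_le : sigma a <= sigma b by rewrite -subr_ge0 sab mulr_ge0.
have de20 : 0 <= 2 * de by lra.
have /andP[_ H2] := loc2 _ _ _ _ st01 de20 sa0 sab_le sb1 stra sbtr.
rewrite sab in H2.
have HB : B b - B a <= L * (ka * D + 2 * eta) * (b - a).
  apply: (@le_trans _ _ (2^-1 * (((d (g1 t) + eta) +
      s * (d (g2 (sigma t)) + eta)) * (L * (b - a))))).
    have Lba : 0 <= L * (b - a) by rewrite mulr_ge0.
    have : (d (g1 t) + K * de) * (L * (b - a)) <= (d (g1 t) + eta) * (L * (b - a)).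
      by rewrite ler_wpM2r//; lra.
    have : s * (L * (b - a)) * (d (g2 (sigma t)) + K * (2 * de)) <=
       s * (L * (b - a)) * (d (g2 (sigma t)) + eta).
      by rewrite ler_wpM2l ?mulr_ge0//; lra.
    move: H1 H2; rewrite /B; lra.
  have -> : L * (ka * D + 2 * eta) * (b - a) = (ka * D + 2 * eta) * (L * (b - a)) by ring.
  rewrite [leLHS]mulrA ler_wpM2r ?mulr_ge0//.
  have := Hka t; rewrite alt tbe => /(_ isT); rewrite /D.
  have : s * eta <= 2 * eta by rewrite ler_wpM2r// ltW.
  lra.
have dc u : a <= u <= b -> D - eta <= d (c u) <= d (c 0) + arclength c 1.
  move=> /andP[au ub]; have u01 : 0 <= u <= 1 by rewrite (le_trans a0)// (le_trans ub).
  have su01 := sigma01 u01.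
  rewrite (dist_path_upper Omega_proper Omega_open Omega_nonempty midpath_rectifiable)// andbT.
  apply: le_trans _ (dist_midpoint Omega_proper Omega_open Omega_nonempty
    Omega_convex (g1O u01) (g2O su01)).
  have := dist_path_lip Omega_proper Omega_open Omega_nonempty g1_fin lip1 t01 u01.
  have := dist_path_lip Omega_proper Omega_open Omega_nonempty g2_fin lip2 st01 su01.
  have : K * `|u - t| <= K * de by apply: ler_wpM2l => //; rewrite ler_norml; lra.
  have : K * `|sigma u - sigma t| <= K * (2 * de).
    apply: ler_wpM2l => //; rewrite ler_norml.
    have [ut|/ltW tu] := leP u t.
      have := sigma_mono (le_trans a0 au) ut (le_trans tb b1); lra.
    have := sigma_mono (le_trans a0 at_) tu (le_trans ub b1); lra.
  move=> I1 I2 /le_trans/(_ I1) + /le_trans/(_ I2).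
  rewrite !ler_norml /D; lra.
have De0 : 0 < D - eta by lra.
have /andP[_ HQ] := qh_param_increment Omega_proper Omega_open Omega_nonempty
  midpath_rectifiable a0 ab b1 De0 dc.
have Hc := arclength_midpath_le a0 ab b1.
have HM : M^-1 <= (D - eta)^-1.
  by rewrite lef_pV2 ?posrE//; have := M_ge t01 st01; rewrite /D; lra.
apply: (@le_trans _ _ ((D - eta)^-1 * (B b - B a))).
  have : M^-1 * ((B b - B a) - (arclength c b - arclength c a)) <=
      (D - eta)^-1 * ((B b - B a) - (arclength c b - arclength c a)).
    by rewrite ler_wpM2r// subr_ge0.
  rewrite /f; lra.
rewrite mulrC ler_pdivrMr//; apply: le_trans HB _.
rewrite [leRHS]mulrAC ler_wpM2r//; lra.
Qed.

End MidpointPath.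

(** * Delaying a path *)

Section Delay.
Context {R : realFieldType}.
Variables (t0 de : R).
Hypothesis (de_gt0 : 0 < de) (de_t0 : de <= t0) (t0_de : t0 + de <= 1).

Local Ltac dlra :=
  have ? := de_gt0; have ? := de_t0; have ? := t0_de; lra.

(** The change of parameter of [0, 1] with slope [1 / 2] on [0, de], slope
    [3 / 2] on [t0, t0 + de] and slope [1] elsewhere. *)
Definition delay (t : R) : R :=
  t - 2^-1 * Num.min t de + 2^-1 * Num.min (Num.max (t - t0) 0) de.

Let m1 (t : R) := Num.min t de.
Let m2 (t : R) := Num.min (Num.max (t - t0) 0) de.

Let m1_le t : t <= de -> m1 t = t. Proof. by move=> ?; exact/min_idPl. Qed.
Let m1_ge t : de <= t -> m1 t = de. Proof. by move=> ?; exact/min_idPr. Qed.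

Let m2_le t : t <= t0 -> m2 t = 0.
Proof.
move=> tt0; rewrite /m2 (_ : Num.max _ _ = 0); first exact/min_idPl/ltW.
by apply/max_idPr; rewrite subr_le0.
Qed.

Let m2_mid t : t0 <= t -> t <= t0 + de -> m2 t = t - t0.
Proof.
move=> tt0 tde; rewrite /m2 (_ : Num.max _ _ = t - t0).
  by apply/min_idPl; dlra.
by apply/max_idPl; rewrite subr_ge0.
Qed.

Let m2_ge t : t0 + de <= t -> m2 t = de.
Proof. by move=> tt0; apply/min_idPr; rewrite le_max; apply/orP; left; dlra. Qed.

Lemma delay_start t : 0 <= t -> t <= de -> delay t = 1 / 2 * t.
Proof. by move=> t_ge0 t_de; rewrite /delay -/(m1 t) -/(m2 t) m1_le// m2_le; dlra. Qed.

Lemma delay_shift t : de <= t -> t <= t0 -> delay t = t - 1 / 2 * de.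
Proof. by move=> de_t t_t0; rewrite /delay -/(m1 t) -/(m2 t) m1_ge// m2_le; dlra. Qed.

Lemma delay_catch_up t : t0 <= t -> t <= t0 + de ->
  delay t = 3 / 2 * (t - t0) + t0 - 1 / 2 * de.
Proof.
by move=> t0_t t_de; rewrite /delay -/(m1 t) -/(m2 t) m1_ge ?m2_mid; dlra.
Qed.

Lemma delay_end t : t0 + de <= t -> delay t = t.
Proof. by move=> t0_t; rewrite /delay -/(m1 t) -/(m2 t) m1_ge ?m2_ge; dlra. Qed.

Lemma delay0 : delay 0 = 0.
Proof. by rewrite delay_start ?mulr0// ltW. Qed.

Lemma delay1 : delay 1 = 1.
Proof. exact: delay_end. Qed.

Lemma delay_mono a b : 0 <= a -> a <= b -> b <= 1 ->
  0 <= delay b - delay a <= 2 * (b - a).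
Proof.
move=> a0 ab b1.
have [ad|da] := leP a de.
  rewrite (delay_start a0 ad); have [bd|db] := leP b de.
    by rewrite delay_start; dlra.
  have [bt|tb] := leP b t0; first by rewrite delay_shift; dlra.
  have [bt|tb'] := leP b (t0 + de); first by rewrite delay_catch_up; dlra.
  by rewrite delay_end; dlra.
have [at_|ta] := leP a t0.
  rewrite (delay_shift (ltW da) at_); have [bt|tb] := leP b t0.
    by rewrite delay_shift; dlra.
  have [bt|tb'] := leP b (t0 + de); first by rewrite delay_catch_up; dlra.
  by rewrite delay_end; dlra.
have [at'|ta'] := leP a (t0 + de).
  rewrite (delay_catch_up (ltW ta) at'); have [bt|tb'] := leP b (t0 + de).
    by rewrite delay_catch_up; dlra.
  by rewrite delay_end; dlra.
by rewrite !delay_end; dlra.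
Qed.

End Delay.

(** The extreme case is that of [u = a + k] and [v = b - k]. *)
Lemma weighted_le (R : realFieldType) (a b k ep u v : R) :
  - 1 <= 2 * ep -> 2 * ep <= 1 -> (1 - 2 * ep) * (a + k) <= (1 + 2 * ep) * (b - k) ->
  `|u - a| <= k -> `|v - b| <= k -> u - v <= 2 * ep * (u + v).
Proof.
move=> ep0 ep1 H; rewrite !ler_norml => /andP[_ uk] /andP[vk _].
have : (1 - 2 * ep) * u <= (1 - 2 * ep) * (a + k) by rewrite ler_wpM2l; lra.
have : (1 + 2 * ep) * (b - k) <= (1 + 2 * ep) * v by rewrite ler_wpM2l; lra.
lra.
Qed.

(** * Comparison of two geodesics *)

Section TwoGeodesics.
Context {R : realType} {X : normedModType R}.
Variable Omega : set X.
Hypothesis Omega_proper : Omega <> setT.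
Hypothesis Omega_open : open Omega.
Hypothesis Omega_nonempty : Omega !=set0.
Hypothesis Omega_convex : convex_set (Omega : set (convex_lmodType X)).
Variables (x y : X) (L : R).
Hypothesis L_min : forall c, rectifiable_path Omega x y c -> L <= qh_param Omega c 1.

Local Notation d z := (dist_set z (boundary Omega)).

Lemma speed0_const g K t : rectifiable_path Omega x y g -> metric_speed Omega g 0 K ->
  0 <= t <= 1 -> g t = x.
Proof.
move=> [_ _ <- _ g_fin] [_ _ _ loc] /andP[t0 t1].
have i0 : 0 <= (0 : R) <= 1 by rewrite lexx ler01.
have l1 : 0 - 1 <= 0 :> R by lra.
have r1 : t <= 0 + 1 by lra.
have /andP[_] := loc 0 0 t 1 i0 ler01 (lexx 0) t0 t1 l1 r1.
rewrite mulr0 mul0r => H; apply/eqP; rewrite -subr_eq0 -normr_eq0 eq_le normr_ge0 andbT.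
exact: le_trans (norm_le_arclength g_fin (lexx 0) t0 t1) H.
Qed.

(** The bound for the quasihyperbolic length of the midpoint path of [g1] and of
    the delayed [g2], with factors [k1] where [g2] is slowed down, [k3] where it
    is accelerated and 1 elsewhere, is at least [L]. *)
Lemma delayed_midpath_qh_ge g1 g2 K t0 de k1 k3 : rectifiable_path Omega x y g1 ->
  rectifiable_path Omega x y g2 -> metric_speed Omega g1 L K ->
  metric_speed Omega g2 L K -> 0 < de -> de <= t0 -> t0 + de <= 1 ->
  0 <= k1 -> 0 <= k3 ->
  let sigma := delay t0 de in
  (forall t, 0 <= t <= de ->
    d (g1 t) + 1 / 2 * d (g2 (sigma t)) <= k1 * (d (g1 t) + d (g2 (sigma t)))) ->
  (forall t, t0 <= t <= t0 + de ->
    d (g1 t) + 3 / 2 * d (g2 (sigma t)) <= k3 * (d (g1 t) + d (g2 (sigma t)))) ->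
  0 <= L * de * (k1 + k3 - 2).
Proof.
move=> g1P g2P ms1 ms2 de0 de_t0 t0_de k1_0 k3_0 sigma H1 H3.
have sigma0 : sigma 0 = 0 by exact: delay0.
have sigma1 : sigma 1 = 1 by exact: delay1.
have sigma_mono := delay_mono de0 de_t0 t0_de : forall a b, 0 <= a -> a <= b ->
  b <= 1 -> 0 <= sigma b - sigma a <= 2 * (b - a).
have [M HM] := dist_path_bound Omega_proper Omega_open Omega_nonempty g1P g2P.
pose c := midpath g1 g2 sigma; pose B := midpath_majorant g1 g2 sigma.
pose f t := qh_param Omega c t + M^-1 * (B t - arclength c t).
have cP : rectifiable_path Omega x y c.
  exact: (midpath_rectifiable Omega_convex g1P g2P ms1 ms2 sigma0 sigma1 sigma_mono).
have B0 : B 0 = 0 by rewrite /B /midpath_majorant sigma0 !arclength0 addr0 mulr0.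
have f0 : f 0 = 0.
  by rewrite /f B0 qh_param0 arclength0 subr0 mulr0 addr0.
have f1 : L <= f 1.
  apply: le_trans (L_min cP) _; rewrite lerDl mulr_ge0 ?invr_ge0//.
    exact/ltW/(dist_path_bound_gt0 Omega_proper Omega_open Omega_nonempty g1P g2P HM).
  have := arclength_midpath_le Omega_convex
    g1P g2P ms1 ms2 sigma0 sigma1 sigma_mono (lexx 0) ler01 (lexx 1).
  by rewrite -/c -/B B0 arclength0 !subr0 subr_ge0.
have piece al be s ka : 0 <= al -> al <= be -> be <= 1 ->
    0 <= s <= 2 -> 0 <= ka ->
    (forall a b, al <= a -> a <= b -> b <= be -> sigma b - sigma a = s * (b - a)) ->
    (forall t, al <= t <= be ->
      d (g1 t) + s * d (g2 (sigma t)) <= ka * (d (g1 t) + d (g2 (sigma t)))) ->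
    f be - f al <= L * ka * (be - al).
  exact: (midpath_qh_piece Omega_proper Omega_open Omega_nonempty Omega_convex
    g1P g2P ms1 ms2 sigma0 sigma1 sigma_mono HM).
(* From here on only the increments of [f] matter. *)
move: f f0 f1 piece => f f0 f1 piece {cP B0 HM M B c sigma0 sigma1 sigma_mono ms1 ms2 g1P g2P}.
have P1 : f de - f 0 <= L * k1 * (de - 0).
  apply: (piece 0 de (1 / 2)) => //; [exact: ltW|lra|lra|].
  by move=> a b a0 ab bd; rewrite /sigma !delay_start//; lra.
have P2 : f t0 - f de <= L * 1 * (t0 - de).
  apply: (piece de t0 1) => //; [exact: ltW|lra|lra| |].
    by move=> a b ad ab bt; rewrite /sigma !delay_shift//; lra.
  by move=> t _; rewrite !mul1r.
have P3 : f (t0 + de) - f t0 <= L * k3 * (t0 + de - t0).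
  apply: (piece t0 (t0 + de) (3 / 2)) => //; [lra|lra|lra|].
  by move=> a b ad ab bt; rewrite /sigma !delay_catch_up//; lra.
have P4 : f 1 - f (t0 + de) <= L * 1 * (1 - (t0 + de)).
  apply: (piece (t0 + de) 1 1) => //; [lra|lra| |].
    by move=> a b ad ab bt; rewrite /sigma !delay_end//; lra.
  by move=> t _; rewrite !mul1r.
move: {H1 H3 piece} f0 f1 P1 P2 P3 P4; lra.
Qed.

(** If [g1] were farther from the boundary than [g2] at time [t0], then delaying
    [g2] near its origin and letting it catch up after [t0] would produce a
    midpoint path shorter than the geodesics. *)
Lemma dist_geodesics_le g1 g2 K : rectifiable_path Omega x y g1 ->
  rectifiable_path Omega x y g2 -> metric_speed Omega g1 L K ->
  metric_speed Omega g2 L K -> forall t, 0 <= t <= 1 -> d (g1 t) <= d (g2 t).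
Proof.
move=> g1P g2P ms1 ms2 t0 t01; rewrite leNgt; apply/negP => d12.
have [g1_0 g1_1] : g1 0 = x /\ g1 1 = y by case: g1P.
have [g2_0 g2_1] : g2 0 = x /\ g2 1 = y by case: g2P.
have [g1O g1_fin] : (forall t, 0 <= t <= 1 -> Omega (g1 t)) /\
  (path_length 0 1 g1 < +oo)%E by case: g1P.
have [g2O g2_fin] : (forall t, 0 <= t <= 1 -> Omega (g2 t)) /\
  (path_length 0 1 g2 < +oo)%E by case: g2P.
have [L_ge0 K0 lip1 _] := ms1; have [_ _ lip2 _] := ms2.
have L0 : 0 < L.
  rewrite lt_neqAle L_ge0 andbT; apply/eqP => LE; move: ms1 ms2; rewrite -LE => ms1 ms2.
  move: d12; rewrite (speed0_const g1P ms1 t01) (speed0_const g2P ms2 t01).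
  by rewrite ltxx.
have /andP[t0_ge0 t0_le1] := t01.
have t0_gt0 : 0 < t0.
  rewrite lt_neqAle t0_ge0 andbT; apply/eqP => E; move: d12.
  by rewrite -E g1_0 g2_0 ltxx.
have t0_lt1 : t0 < 1.
  rewrite lt_neqAle t0_le1 andbT; apply/eqP => E; move: d12.
  by rewrite E g1_1 g2_1 ltxx.
have i0 : 0 <= (0 : R) <= 1 by rewrite lexx ler01.
have D0_gt0 : 0 < d x by rewrite -g1_0 dist_gt0//; exact: g1O.
(* For a short delay, the ratio of [d (g2 _)] to the sum of the two distances will
   be at least [1 / 2 - ep] near the origin and at most [1 / 2 - 2 * ep] near [t0]. *)
have [ep [ep0 ep1 epE]] : exists ep : R, [/\ 0 < ep, 4 * ep <= 1 &
    8 * ep * (d (g1 t0) + d (g2 t0)) = d (g1 t0) - d (g2 t0)].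
  have a1 : 0 < d (g1 t0) by rewrite dist_gt0//; exact: g1O.
  have a2 : 0 < d (g2 t0) by rewrite dist_gt0//; exact: g2O.
  have den : 0 < 8 * (d (g1 t0) + d (g2 t0)) by rewrite mulr_gt0// addr_gt0.
  pose e := (d (g1 t0) - d (g2 t0)) / (8 * (d (g1 t0) + d (g2 t0))).
  have eE : e * (8 * (d (g1 t0) + d (g2 t0))) = d (g1 t0) - d (g2 t0).
    by rewrite divfK// lt0r_neq0.
  exists e; split; last by rewrite -eE; ring.
    by rewrite divr_gt0// subr_gt0.
  by rewrite mulrA ler_pdivrMr//; lra.
pose m := Num.min t0 (1 - t0).
pose q := Num.min ((d (g1 t0) - d (g2 t0)) / 4) (2 * ep * d x).
have q0 : 0 < q by rewrite lt_min divr_gt0 ?subr_gt0// !mulr_gt0.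
have m0 : 0 < m by rewrite lt_min t0_gt0 subr_gt0.
pose de := Num.min m (q / (K + 1)).
have K10 : 0 < K + 1 by rewrite ltr_wpDl.
have de0 : 0 < de by rewrite lt_min m0 divr_gt0.
have de_t0 : de <= t0 by rewrite !ge_min lexx.
have t0_de : t0 + de <= 1 by rewrite -lerBrDl !ge_min lexx !orbT.
have Kde_q : K * de <= q.
  apply: (@le_trans _ _ ((K + 1) * de)); first by rewrite ler_pM2r// lerDl.
  by rewrite mulrC -ler_pdivlMr// ge_min lexx orbT.
have Kde_a : K * de <= (d (g1 t0) - d (g2 t0)) / 4.
  by apply: le_trans Kde_q _; rewrite ge_min lexx.
have Kde_D : K * de <= 2 * ep * d x.
  by apply: le_trans Kde_q _; rewrite ge_min lexx orbT.
have delay01 t : 0 <= t <= 1 -> 0 <= delay t0 de t <= 1.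
  move=> /andP[u0 u1]; have := delay_mono de0 de_t0 t0_de (lexx 0) u0 u1.
  have := delay_mono de0 de_t0 t0_de u0 u1 (lexx 1).
  rewrite delay0// delay1//; move: {-}(delay _ _ _) u0 u1 => v; lra.
have near g s t : (path_length 0 1 g < +oo)%E ->
    (forall a b, 0 <= a -> a <= b -> b <= 1 -> arclength g b - arclength g a <= K * (b - a)) ->
    0 <= s <= 1 -> 0 <= t <= 1 -> `|t - s| <= de -> `|d (g t) - d (g s)| <= K * de.
  move=> g_fin lip s01 t_01 st.
  apply: le_trans (dist_path_lip Omega_proper Omega_open Omega_nonempty g_fin lip s01 t_01) _.
  exact: ler_wpM2l.
(* [3 / 4 + ep / 2 = 1 - (1 / 2 - ep) / 2] and [5 / 4 - ep = 1 + (1 / 2 - 2 * ep) / 2]. *)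
suff : 0 <= L * de * ((3 / 4 + ep / 2) + (5 / 4 - ep) - 2).
  have : 0 < L * de * ep by rewrite mulr_gt0// mulr_gt0.
  by lra.
apply: (delayed_midpath_qh_ge g1P g2P ms1 ms2 de0 de_t0 t0_de).
- by move: ep0 ep1; lra.
- by move: ep0 ep1; lra.
- move=> t /andP[t_ge0 t_de].
  have t_01 : 0 <= t <= 1 by rewrite t_ge0 (le_trans t_de)// (le_trans de_t0).
  have H1 : `|d (g1 t) - d x| <= K * de.
    rewrite -g1_0; apply: near => //; rewrite subr0 ger0_norm//.
  have H2 : `|d (g2 (delay t0 de t)) - d x| <= K * de.
    rewrite -g2_0; apply: near => //; first exact: delay01.
    have /andP[s0 _] := delay01 t t_01; rewrite subr0 ger0_norm//.
    by rewrite delay_start//; move: t_ge0 t_de; lra.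
  have := weighted_le (ep := ep) _ _ _ H1 H2.
  move=> /(_ _ _ _)/wrap[|||]; [by move: ep0; lra|by move: ep0 ep1; lra| |by lra].
  by move: Kde_D; lra.
- move=> t /andP[t0_t t_de].
  have t_01 : 0 <= t <= 1 by rewrite (le_trans t0_ge0)// (le_trans t_de).
  have H1 : `|d (g1 t) - d (g1 t0)| <= K * de.
    by apply: near => //; rewrite ger0_norm ?subr_ge0// lerBlDl.
  have H2 : `|d (g2 (delay t0 de t)) - d (g2 t0)| <= K * de.
    apply: near => //; first exact: delay01.
    rewrite delay_catch_up// ler_norml; move: t0_t t_de de0; lra.
  have K_ge0 : 0 <= K * de by rewrite mulr_ge0// ltW.
  have := weighted_le (ep := - (2 * ep)) _ _ _ H2 H1.
  move=> /(_ _ _ _)/wrap[|||]; [by move: ep0 ep1; lra|by move: ep0 ep1; lra| |by lra].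
  by move: Kde_a epE; lra.
Qed.

(** Lengths are compared through their local rates of growth [L * d (g1 t)] and
    [L * d (g2 t)]. *)
Lemma arclength_le_of_dist g1 g2 K : metric_speed Omega g1 L K ->
  metric_speed Omega g2 L K ->
  (forall t, 0 <= t <= 1 -> d (g1 t) <= d (g2 t)) ->
  forall t, 0 <= t <= 1 -> arclength g1 t <= arclength g2 t.
Proof.
move=> [L0 K0 _ loc1] [_ _ _ loc2] d12 t /andP[t0 t1].
pose f u := arclength g1 u - arclength g2 u.
suff : f t - f 0 <= 0 * (t - 0) by rewrite /f !arclength0; lra.
apply: le_increment_local => // u k' /andP[u0 ut] k'0.
have KL : 0 <= K * L by rewrite mulr_ge0.
have den : 0 < 2 * (K * L) + 1 by lra.
have u01 : 0 <= u <= 1 by rewrite u0 (le_trans ut).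
pose de := k' / (2 * (K * L) + 1).
have de0 : 0 < de by rewrite divr_gt0.
have deE : de * (2 * (K * L) + 1) = k' by rewrite divfK// lt0r_neq0.
exists de => // a b a0 ua au ub bu bt.
have ab : a <= b by lra.
have b1 : b <= 1 by lra.
have ua' : u - de <= a by lra.
have bu' : b <= u + de by lra.
have /andP[_ H1] := loc1 u a b de u01 (ltW de0) a0 ab b1 ua' bu'.
have /andP[H2 _] := loc2 u a b de u01 (ltW de0) a0 ab b1 ua' bu'.
have Lab : 0 <= L * (b - a) by rewrite mulr_ge0// subr_ge0.
have H3 : d (g1 u) * (L * (b - a)) <= d (g2 u) * (L * (b - a)).
  by rewrite ler_wpM2r// d12.
have H4 : (2 * (K * L) * de) * (b - a) <= k' * (b - a).
  by rewrite ler_wpM2r ?subr_ge0//; lra.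
rewrite /f; lra.
Qed.

(** The length of the midpoint path of two geodesics is not smaller than the mean of
    their lengths: a loss of length would make its quasihyperbolic length smaller
    than [L]. *)
Lemma midpath_geodesics_length g1 g2 K : rectifiable_path Omega x y g1 ->
  rectifiable_path Omega x y g2 -> metric_speed Omega g1 L K ->
  metric_speed Omega g2 L K ->
  2^-1 * (arclength g1 1 + arclength g2 1) <= arclength (midpath g1 g2 id) 1.
Proof.
move=> g1P g2P ms1 ms2.
have [M HM] := dist_path_bound Omega_proper Omega_open Omega_nonempty g1P g2P.
have id_mono (a b : R) : 0 <= a -> a <= b -> b <= 1 -> 0 <= id b - id a <= 2 * (b - a).
  by move=> _ ab _ /=; lra.
have M0 := dist_path_bound_gt0 Omega_proper Omega_open Omega_nonempty g1P g2P HM.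
have s2 : 0 <= (1 : R) <= 2 by lra.
have slope a b : 0 <= a -> a <= b -> b <= 1 -> id b - id a = 1 * (b - a) :> R.
  by rewrite mul1r.
have := midpath_qh_piece Omega_proper Omega_open Omega_nonempty Omega_convex
  g1P g2P ms1 ms2 (erefl (id 0)) (erefl (id 1)) id_mono HM (lexx 0) ler01 (lexx 1)
  s2 ler01 slope.
move=> /(_ _)/wrap[t _|/=]; first by rewrite !mul1r.
rewrite qh_param0 /midpath_majorant !arclength0 addr0 mulr0 subr0 mulr0 addr0 !subr0 !mulr1.
have := L_min (midpath_rectifiable Omega_convex g1P g2P ms1 ms2 (erefl (id 0)) (erefl (id 1)) id_mono).
move=> H1 H2; have : M^-1 * (2^-1 * (arclength g1 1 + arclength g2 1) -
    arclength (midpath g1 g2 id) 1) <= 0 by lra.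
by rewrite pmulr_rle0 ?invr_gt0// subr_le0.
Qed.

End TwoGeodesics.

(** * Vector measures and simple functions *)

Lemma measure_lty_fin_num {d} {T : measurableType d} {R : realType}
    (m : {measure set T -> \bar R}) : (m setT < +oo)%E ->
  forall E, measurable E -> m E \is a fin_num.
Proof.
move=> m_fin E mE; rewrite ge0_fin_numE//; apply: le_lt_trans m_fin.
by apply: le_measure => //; rewrite inE.
Qed.

Section VectorMeasureTheory.
Context {R : realType} {X : normedModType R} {d : measure_display}
  {T : measurableType d}.
Implicit Types (mu : set T -> X) (A B E F : set T).

(** Additivity on pairs of disjoint measurable sets. *)
Definition finitely_additive {V : zmodType} (mu : set T -> V) :=
  forall A B, measurable A -> measurable B -> A `&` B = set0 -> mu (A `|` B) = mu A + mu B.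

Lemma vector_measure0 mu : vector_measure mu -> mu set0 = 0.
Proof.
move=> /(_ (fun=> set0) (fun=> measurable0)).
rewrite bigcup0// => /(_ _)/wrap[|H].
  by apply/trivIsetP => i j _ _ _; rewrite setI0.
have H' : (\sum_(0 <= i < n.+1) mu set0) @[n --> \oo] --> mu set0.
  by rewrite (cvg_shiftS (fun n => \sum_(0 <= i < n) mu set0)).
have : (\sum_(0 <= i < n.+1) mu set0 - \sum_(0 <= i < n) mu set0) @[n --> \oo]
   --> mu set0 - mu set0 by exact: cvgB.
rewrite subrr (_ : (fun _ => _) = cst (mu set0)); last first.
  by apply/funext => n; rewrite big_nat_recr//= addrAC subrr add0r.
move=> /cvg_lim <- //; rewrite lim_cst//.
Qed.

Lemma vector_measure_additive mu : vector_measure mu -> finitely_additive mu.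
Proof.
move=> vmu A B mA mB AB0; have mu0 := vector_measure0 vmu.
pose G := bigcup2 A B.
have : (\sum_(0 <= i < n) mu (G i)) @[n --> \oo] --> mu (\bigcup_i G i).
  apply: vmu; last by rewrite /G -trivIset_bigcup2.
  by move=> [|[|i]]; rewrite /G/bigcup2/=.
rewrite /G bigcup2E => /cvg_lim <- //.
apply: lim_near_cst => //; near=> n.
have n2 : (2 <= n)%N by near: n; exists 2%N.
rewrite -(subnK n2) addn2.
rewrite big_nat_recl//= big_nat_recl//= big1 ?addr0//.
Unshelve. all: by end_near. Qed.

Lemma finitely_additiveID (V : zmodType) (mu : set T -> V) E F : finitely_additive mu ->
  measurable E -> measurable F -> mu F = mu (F `&` E) + mu (F `\` E).
Proof.
move=> amu mE mF; rewrite -amu//; [|exact: measurableI|exact: measurableD|].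
  by rewrite setUIDK.
by rewrite setIDA setIAC -setIDA setDv setI0.
Qed.

Section Variation.
Variable m : {measure set T -> \bar R}.
Hypothesis m_fin : (m setT < +oo)%E.

Let mE_fin := measure_lty_fin_num m_fin.

Lemma vvariation_le mu (C : R) E : measurable E ->
  (forall F, measurable F -> F `<=` E -> `|mu F| <= C * fine (m F)) ->
  (vvariation mu E <= C%:E * m E)%E.
Proof.
move=> mE H; apply: ge_ereal_sup => _ [n [F [mF tF UF ->]]].
have -> : m E = (\sum_(i < n) m (F i))%E.
  rewrite -measure_semi_additive_ord_I//; first by rewrite -bigcup_mkord UF.
  exact: bigsetU_measurable.
rewrite -[X in (_ <= _ * X)%E]fineK; last first.
  by apply/sum_fin_numP => i _ _; exact: mE_fin.
rewrite -EFinM lee_fin -sum_fine; last by move=> i _; exact: mE_fin.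
rewrite mulr_sumr; apply: ler_sum => i _; apply: H => //.
by rewrite -UF => x Fx; exists (i : nat) => //=.
Qed.

Lemma vvariation_setT_le mu E : finitely_additive mu -> measurable E ->
  (vvariation mu setT <= vvariation mu E + vvariation mu (~` E))%E.
Proof.
move=> amu mE; apply: ge_ereal_sup => _ [n [F [mF tF UF ->]]].
have H (D : set T) : measurable D ->
    ((\sum_(i < n) `|mu (F i `&` D)|)%:E <= vvariation mu D)%E.
  move=> mD; apply: ereal_sup_ubound; exists n, (fun i => F i `&` D); split => //.
  - by move=> i; exact: measurableI.
  - exact: trivIset_setIr.
  - by rewrite -setI_bigcupl UF setTI.
apply: (@le_trans _ _ ((\sum_(i < n) `|mu (F i `&` E)|)%:E +
   (\sum_(i < n) `|mu (F i `&` ~` E)|)%:E))%E; last first.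
  by apply: leeD; apply: H => //; exact: measurableC.
rewrite -EFinD lee_fin -big_split/=; apply: ler_sum => i _.
by rewrite {1}(finitely_additiveID amu mE (mF i)) setDE ler_normD.
Qed.

(** A bound which the total variation attains on the whole space is attained on
    every measurable set. *)
Lemma vvariation_eq mu : finitely_additive mu ->
  (forall E, measurable E -> `|mu E| <= fine (m E)) ->
  (m setT <= vvariation mu setT)%E ->
  forall E, measurable E -> vvariation mu E = m E.
Proof.
move=> amu mum Tle E mE.
have le D : measurable D -> (vvariation mu D <= m D)%E.
  move=> mD; rewrite -[X in (_ <= X)%E]mul1e; apply: vvariation_le => // F mF _.
  by rewrite mul1r mum.
apply/le_anti; rewrite le//=.
have := le_trans Tle (vvariation_setT_le amu mE).
have mCE : measurable (~` E) by exact: measurableC.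
rewrite -(setUv E) measureU//; last by rewrite setICr.
move=> /le_trans/(_ (leeD (lexx _) (le _ mCE))).
by rewrite leeD2rE// mE_fin.
Qed.

End Variation.

Lemma finitely_additive0 (V : zmodType) (mu : set T -> V) :
  finitely_additive mu -> mu set0 = 0.
Proof.
move=> /(_ set0 set0 measurable0 measurable0); rewrite setU0 setI0 => /(_ erefl).
by move=> /eqP; rewrite -[X in X == _]addr0 (inj_eq (addrI _)) eq_sym => /eqP.
Qed.

Lemma finitely_additive_simple (V : zmodType) (mu : set T -> V) s E :
  finitely_additive mu -> @simple_fun _ X _ _ s -> measurable E ->
  mu E = \sum_(w <- fset_set (range s)) mu (E `&` s @^-1` [set w]).
Proof.
move=> amu [fs ms] mE.
have H (l : seq X) : uniq l ->
    measurable (E `&` [set x | s x \in l]) /\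
    mu (E `&` [set x | s x \in l]) = \sum_(w <- l) mu (E `&` s @^-1` [set w]).
  elim: l => [_|w l IH /= /andP[wl /IH[mI {}IH]]].
    rewrite big_nil (_ : _ `&` _ = set0) ?finitely_additive0//.
    by apply/seteqP; split => x //= [].
  have mw : measurable (E `&` s @^-1` [set w]) by exact: measurableI.
  have -> : E `&` [set x | s x \in w :: l] =
      (E `&` s @^-1` [set w]) `|` (E `&` [set x | s x \in l]).
    rewrite -setIUr; congr (_ `&` _); apply/seteqP; split => x /=.
      by rewrite inE => /orP[/eqP|]; [left|right].
    by rewrite inE => -[->|->]; rewrite ?eqxx ?orbT.
  split; first exact: measurableU.
  rewrite amu// ?big_cons ?IH//; apply/seteqP; split => x //= [[_ ->]] [_].
  by rewrite (negbTE wl).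
rewrite -(H _ _).2 ?fset_uniq//; congr mu.
apply/seteqP; split => [x Ex|x []//]; split => //=.
by rewrite in_fset_set// inE; exists x.
Qed.

Import HBNNSimple.

(** The integral only evaluates its set function on measurable sets. *)
Lemma eq_integral_set_function (m1 m2 : set T -> \bar R) (f : T -> \bar R) :
  (forall A, measurable A -> m1 A = m2 A) ->
  (\int[m1]_x f x = \int[m2]_x f x)%E.
Proof.
move=> m12.
have H (h : {nnsfun T >-> R}) : sintegral m1 h = sintegral m2 h.
  by apply: eq_fsbigr => x _; rewrite m12.
by rewrite /integral; congr (ereal_sup _ - ereal_sup _)%E;
  apply: eq_imagel => h _; rewrite H.
Qed.

Section SimpleApproximation.
Variable m : {measure set T -> \bar R}.
Hypothesis m_fin : (m setT < +oo)%E.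

Let mE_fin := measure_lty_fin_num m_fin.

Lemma finitely_additive_fine : finitely_additive (fine \o m).
Proof.
by move=> A B mA mB AB0 /=; rewrite measureU// fineD//; exact: mE_fin.
Qed.

Lemma fine_measure_le A B : measurable A -> measurable B -> A `<=` B ->
  fine (m A) <= fine (m B).
Proof.
by move=> mA mB AB; apply: fine_le; rewrite ?mE_fin//; apply: le_measure;
  rewrite ?inE.
Qed.

Lemma fine_measureID A B : measurable A -> measurable B ->
  fine (m A) = fine (m (A `&` B)) + fine (m (A `\` B)).
Proof.
by move=> mA mB; exact: (finitely_additiveID finitely_additive_fine).
Qed.

(** No measurability is needed: both sides are suprema over simple functions. *)
Lemma ge0_le_integral_total (f g : T -> \bar R) :
  (forall x, 0 <= f x)%E -> (forall x, f x <= g x)%E ->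
  (\int[m]_x f x <= \int[m]_x g x)%E.
Proof.
move=> f0 fg; rewrite !ge0_integralTE//; last first.
  by move=> x; exact: le_trans (fg x).
apply: le_ereal_sup => _ [h hf <-]; exists h => // x.
exact: le_trans (hf x) (fg x).
Qed.

(** The integral of a simple function [s] over a set where [phi] is [r]-close to
    [v] is [m E *: v], up to [r * m E] and the mean distance from [s] to [phi]. *)
Lemma simple_integral_near (phi s : T -> X) E (v : X) (r : R) :
  measurable E -> simple_fun s -> 0 <= r ->
  (forall x, E x -> `|phi x - v| <= r) ->
  (`|simple_integral m E s - fine (m E) *: v|%:E <=
    (r * fine (m E))%:E + \int[m]_x `|phi x - s x|%:E)%E.
Proof.
move=> mE ss r0 Er; have [fs ms] := ss.
pose W := fset_set (range s); pose P w := E `&` s @^-1` [set w].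
have mP w : measurable (P w) by exact: measurableI.
pose u (w : X) : R := Num.max 0 (`|w - v| - r).
have u0 w : 0 <= u w by rewrite /u le_max lexx.
have mEW : fine (m E) = \sum_(w <- W) fine (m (P w)).
  exact: (finitely_additive_simple finitely_additive_fine ss mE).
(* [u w] is the part of the distance from [w] to [v] exceeding [r]; where [s]
   takes the value [w], it is at most the distance from [phi] to [s]. *)
have step1 : `|simple_integral m E s - fine (m E) *: v| <=
    r * fine (m E) + \sum_(w <- W) u w * fine (m (P w)).
  rewrite /simple_integral fsbig_finite//= mEW scaler_suml -sumrB mulr_sumr.
  rewrite -big_split/=; apply: le_trans (ler_norm_sum _ _ _) _.
  apply: ler_sum => w _; rewrite -scalerBr normrZ ger0_norm ?fine_ge0//.
  rewrite -mulrDl mulrC ler_wpM2r ?fine_ge0//.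
  by rewrite -lerBlDl /u le_max lexx orbT.
apply: le_trans (_ : _ <= (r * fine (m E) + \sum_(w <- W) u w * fine (m (P w)))%:E)%E _.
  by rewrite lee_fin.
rewrite EFinD leeD2l// -sumEFin.
have -> : (\sum_(w <- W) (u w * fine (m (P w)))%:E)%E =
    (\int[m]_x (\sum_(w <- W) (u w * \1_(P w) x)%:E))%E.
  rewrite ge0_integral_sum//.
  - apply: eq_bigr => w _.
    under eq_integral do rewrite EFinM.
    rewrite ge0_integralZl ?lee_fin//; last 1 first.
      exact/measurable_EFinP.
    by rewrite integral_indic// setIT EFinM fineK// mE_fin.
  - by move=> w; apply/measurable_EFinP; apply: measurable_funM.
  - by move=> w x _; rewrite lee_fin mulr_ge0.
apply: ge0_le_integral_total => x.
  by apply: sume_ge0 => w _; rewrite lee_fin mulr_ge0.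
rewrite sumEFin lee_fin.
have [Ex|Ex] := pselect (E x); last first.
  rewrite big1// => w _; rewrite indicE (_ : _ \in _ = false) ?mulr0//.
  by apply/negbTE/negP; rewrite inE => -[].
rewrite (bigD1_seq (s x)) ?fset_uniq//=; last first.
  by rewrite in_fset_set// inE; exists x.
rewrite big1 ?addr0; last first.
  move=> w wx; rewrite indicE (_ : _ \in _ = false) ?mulr0//.
  by apply/negbTE/negP; rewrite inE => -[_ /= sxw]; rewrite sxw eqxx in wx.
rewrite indicE mem_set// mulr1 /u ge_max normr_ge0/=.
rewrite lerBlDl; apply: le_trans (_ : `|phi x - v| + `|phi x - s x| <= _).
  rewrite (_ : s x - v = (phi x - v) - (phi x - s x)) ?ler_normB//.
  by rewrite opprB [RHS]addrC addrA subrK.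
by rewrite lerD2r Er.
Qed.

End SimpleApproximation.

End VectorMeasureTheory.

(** * Densities *)

Section Density.
Context {R : realType} {X : normedModType R} {d : measure_display}
  {T : measurableType d}.
Variable m : {measure set T -> \bar R}.
Hypothesis m_fin : (m setT < +oo)%E.
Implicit Types (mu : set T -> X) (A B E F : set T).

Local Notation M E := (fine (m E)).

Let mE_fin := measure_lty_fin_num m_fin.

Lemma simple2_measurable (s t : T -> X) (P : X -> X -> Prop) :
  simple_fun s -> simple_fun t -> measurable [set x | P (s x) (t x)].
Proof.
move=> [fs ms] [ft mt].
rewrite (_ : mkset _ = \bigcup_(v in range s) \bigcup_(w in range t `&` P v)
   (s @^-1` [set v] `&` t @^-1` [set w])).
  apply: fin_bigcup_measurable => // v _; apply: fin_bigcup_measurable.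
    exact: finite_setIl.
  by move=> w _; exact: measurableI.
apply/seteqP; split => [x /= Px|x [_ [y _ <-]] [_ [[z _ <-] /= Pyz] [/= -> ->]]//].
by exists (s x) => //; exists (t x).
Qed.

Lemma simple2_measurable_fun (s t : T -> X) (F : X -> X -> R) (D : set T) :
  measurable D -> simple_fun s -> simple_fun t ->
  measurable_fun D (fun x => F (s x) (t x)).
Proof.
move=> mD ss st _ Y mY; apply: measurableI => //.
exact: (simple2_measurable (fun v w => Y (F v w))).
Qed.

(** [phi] is the limit of the simple functions [s n] outside the null set [N], and
    the mean of [mu] over [E] is [r]-close to [v] whenever [phi] is on [E].  This
    consequence of [mu E] being the Bochner integral of [phi] over [E] is all
    that is used about [phi]. *)
Definition is_density mu (phi : T -> X) (s : nat -> T -> X) (N : set T) :=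
  [/\ forall n, simple_fun (s n), measurable N, m N = 0%E,
      forall x, ~ N x -> s n x @[n --> \oo] --> phi x
    & forall E (v : X) (r : R), measurable E -> 0 <= r ->
        (forall x, E x -> `|phi x - v| <= r) ->
        `|mu E - M E *: v| <= r * M E].

Lemma rnp_density mu : radon_nikodym_property X -> vector_measure mu ->
  (forall E, measurable E -> `|mu E| <= M E) ->
  (m setT <= vvariation mu setT)%E ->
  exists phi s N, is_density mu phi s N.
Proof.
move=> rnp vmu mum mT; have amu := vector_measure_additive vmu.
have nuE := vvariation_eq m_fin amu mum mT.
have nufin : (vvariation mu setT < +oo)%E by rewrite nuE.
have [phi [[s ss [N [mN N0 sN]]] _] H] := rnp _ _ _ vmu nufin.
exists phi, s, N; split => //; first by rewrite -nuE.
  by move=> x Nx; apply: contrapT => Hx; apply/Nx/sN.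
move=> E v r mE r0 Er; have [s' [ss' s'0] s'E] := H E mE.
apply/ler_addgt0Pr => e e0.
have {}s'0 : (\int[m]_x `|phi x - s' n x|%:E)%E @[n --> \oo] --> 0%E.
  apply: cvg_trans s'0; apply: near_eq_cvg; near=> n.
  exact: eq_integral_set_function.
have e2 : 0 < e / 2 by rewrite divr_gt0.
have [n [Hn1 Hn2]] : exists n, (\int[m]_x `|phi x - s' n x|%:E <= (e / 2)%:E)%E /\
    `|mu E - simple_integral (vvariation mu) E (s' n)| < e / 2.
  move/fine_cvgP : s'0 => [fin0 /cvgrPdist_lt lt0].
  near \oo => n; exists n; split.
    have fn : (\int[m]_x `|phi x - s' n x|%:E)%E \is a fin_num by near: n.
    rewrite -(fineK fn) lee_fin; apply: le_trans (ler_norm _) _.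
    by rewrite -normrN -sub0r ltW//; near: n; exact: lt0.
  by near: n; move/cvgrPdist_lt : s'E; exact.
have SE : simple_integral (vvariation mu) E (s' n) = simple_integral m E (s' n).
  apply: eq_fsbigr => w _; rewrite nuE//; apply: measurableI => //.
  exact: (ss' n).2.
have := simple_integral_near m_fin mE (ss' n) r0 Er.
move/le_trans => /(_ _ (leeD2l _ Hn1)); rewrite -EFinD lee_fin -SE => Hn3.
rewrite -(subrK (simple_integral (vvariation mu) E (s' n)) (mu E)) -addrA.
apply: le_trans (ler_normD _ _) _; lra.
Unshelve. all: by end_near. Qed.

(** Lusin: up to a set of small measure, a density is uniformly close to a
    simple function. *)
Lemma density_near_simple mu phi s N (r e : R) : is_density mu phi s N ->
  0 < r -> 0 < e -> exists A t, [/\ measurable A, simple_fun t, M (~` A) < e &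
    forall x, A x -> `|phi x - t x| <= r].
Proof.
move=> [ss mN N0 sphi _] r0 e0.
(* The simple function is [s n], on the set where the sequence varies by at most [r]
   from rank [n] on; these sets increase to the complement of [N]. *)
pose B n := ~` N `&` \bigcap_(k in [set k | (n <= k)%N])
   \bigcap_(l in [set l | (n <= l)%N]) [set x | `|s k x - s l x| <= r].
have mB n : measurable (B n).
  apply: measurableI; first exact: measurableC.
  apply: bigcap_measurable => [|k _]; first by exists n => /=.
  apply: bigcap_measurable => [|l _]; first by exists n => /=.
  exact: (simple2_measurable (fun v w => `|v - w| <= r)).
have B_nd : nondecreasing_seq B.
  move=> n p np; apply/subsetPset => x [Nx Bx]; split => // k pk l pl.
  by apply: Bx => /=; exact: leq_trans np _.
have UB : \bigcup_n B n = ~` N.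
  apply/seteqP; split => [x [n _ []//]|x Nx].
  have := sphi x Nx; move/cvgrPdist_lt => /(_ (r / 2)).
  rewrite divr_gt0// => /(_ isT) [p _ Hp]; exists p => //; split => // k pk l pl.
  have /= := Hp k pk; have /= := Hp l pl => H1 H2.
  rewrite -(subrK (phi x) (s k x)) -addrA.
  apply: le_trans (ler_normD _ _) _; rewrite (distrC (s k x)); lra.
have mNT : m (~` N) = m setT.
  have -> : m setT = (m N + m (~` N))%E.
    by rewrite -measureU ?setUv ?setICr//; exact: measurableC.
  by rewrite N0 add0e.
have : (m \o B) n @[n --> \oo] --> m (\bigcup_n B n).
  by apply: nondecreasing_cvg_mu => //; exact: bigcup_measurable.
rewrite UB mNT -(fineK (mE_fin measurableT)) => /fine_cvgP[_].
move=> /cvgrPdist_lt/(_ e e0)[n _ /(_ n (leqnn n))] /= Bn.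
exists (B n), (s n); split => //.
  have := fine_measureID m_fin measurableT (mB n); rewrite setTI setTD => MT.
  by apply: le_lt_trans Bn; rewrite MT addrAC subrr add0r ler_norm.
move=> x [Nx Bx]; apply/ler_addgt0Pr => z z0.
have /cvgrPdist_lt/(_ z z0)[k _ Hk] := sphi x Nx.
have /= H1 := Hk (maxn k n) (leq_maxl _ _).
have /= H2 := Bx (maxn k n) (leq_maxr _ _) n (leqnn n).
rewrite -(subrK (s (maxn k n) x) (phi x)) -addrA.
apply: le_trans (ler_normD _ _) _; lra.
Qed.

End Density.

(** * Vector measures with a sum of full variation *)

Section EqualMeasures.
Context {R : realType} {X : normedModType R} {d : measure_display}
  {T : measurableType d}.
Variable m : {measure set T -> \bar R}.
Hypothesis m_fin : (m setT < +oo)%E.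
Implicit Types (mu : set T -> X) (A B E F : set T).

Local Notation M E := (fine (m E)).

Let mE_fin := measure_lty_fin_num m_fin.

Lemma simple_piece (t : T -> X) B : simple_fun t -> measurable B -> 0 < M B ->
  exists2 v, measurable (B `&` t @^-1` [set v]) & 0 < M (B `&` t @^-1` [set v]).
Proof.
move=> st mB; have mBv v : measurable (B `&` t @^-1` [set v]).
  by apply: measurableI => //; exact: st.2.
have /= -> := finitely_additive_simple (finitely_additive_fine m_fin) st mB.
move=> H; apply: contrapT => Hv; move: H; apply/negP; rewrite -leNgt.
rewrite big1// => v _; apply/eqP; rewrite eq_le fine_ge0// andbT leNgt.
by apply/negP => vB; apply: Hv; exists v.
Qed.

Variables (mu1 mu2 : set T -> X) (phi1 phi2 : T -> X) (s1 s2 : nat -> T -> X).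
Variables (N1 N2 : set T).
Hypothesis (D1 : is_density m mu1 phi1 s1 N1) (D2 : is_density m mu2 phi2 s2 N2).

(** Every non-null set contains a non-null set on which both densities are nearly
    constant. *)
Lemma densities_near_constant B (r : R) : measurable B -> 0 < M B -> 0 < r ->
  exists E v w, [/\ measurable E, E `<=` B, 0 < M E &
    forall x, E x -> `|phi1 x - v| <= r /\ `|phi2 x - w| <= r].
Proof.
move=> mB B0 r0; have B20 : 0 < M B / 2 by rewrite divr_gt0.
have [A1 [t1 [mA1 st1 A1B t1r]]] := density_near_simple m_fin D1 r0 B20.
have [A2 [t2 [mA2 st2 A2B t2r]]] := density_near_simple m_fin D2 r0 B20.
have mA : measurable (A1 `&` A2) by exact: measurableI.
have mC1 : measurable (~` A1) by exact: measurableC.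
have mC2 : measurable (~` A2) by exact: measurableC.
have H1 : 0 < M (B `&` (A1 `&` A2)).
  have := fine_measureID m_fin mB mA.
  have : M (B `\` (A1 `&` A2)) <= M (~` A1) + M (~` A2).
    have mU : measurable (~` A1 `|` ~` A2) by exact: measurableU.
    apply: (@le_trans _ _ (M (~` A1 `|` ~` A2))).
      apply: (fine_measure_le m_fin) => //; first exact: measurableD.
      by rewrite -setCI => x [].
    rewrite -fineD ?mE_fin// fine_le ?fin_numD ?mE_fin//.
    exact: measureU2.
  lra.
have [v mv v0] := simple_piece st1 (measurableI _ _ mB mA) H1.
have [w mw w0] := simple_piece st2 mv v0.
exists ((B `&` (A1 `&` A2)) `&` t1 @^-1` [set v] `&` t2 @^-1` [set w]), v, w.
split => //; first by move=> x [[[]]].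
by move=> x /= [[[_ [A1x A2x]] <-] <-]; split; [exact: t1r|exact: t2r].
Qed.

Hypothesis (amu1 : finitely_additive mu1) (amu2 : finitely_additive mu2).
Hypothesis (mum1 : forall E, measurable E -> `|mu1 E| <= M E).
Hypothesis (mum2 : forall E, measurable E -> `|mu2 E| <= M E).

Let exists_pt E : 0 < M E -> exists x, E x.
Proof.
move=> E0; apply: contrapT => H; move: E0; rewrite (_ : E = set0) ?measure0 ?ltxx//.
by apply/seteqP; split => // x Ex; apply: H; exists x.
Qed.

(* A vector [r]-close to the mean of [mu] over [E] has norm at most [1 + r]. *)
Let near_le1 mu E (v : X) (r : R) : measurable E -> 0 < M E ->
  `|mu E| <= M E -> `|mu E - M E *: v| <= r * M E -> `|v| <= 1 + r.
Proof.
move=> mE E0 muE H; rewrite -(ler_pM2l E0).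
have -> : M E * `|v| = `|M E *: v| by rewrite normrZ gtr0_norm.
rewrite -(subrK (mu E) (M E *: v)) mulrDr mulr1 addrC.
by rewrite (le_trans (ler_normD _ _))// lerD// distrC mulrC.
Qed.

Let N := N1 `|` N2.

Let mN : measurable N.
Proof. by apply: measurableU; [case: D1|case: D2]. Qed.

Let measurable_nonnull (F : X -> X -> R) (Y : set R) : measurable Y ->
  (forall x, ~ N x -> F (s1 n x) (s2 n x) @[n --> \oo] --> F (phi1 x) (phi2 x)) ->
  measurable (~` N `&` [set x | Y (F (phi1 x) (phi2 x))]).
Proof.
move=> mY HF; have mCN : measurable (~` N) by exact: measurableC.
have [ss1 _ _ _ _] := D1; have [ss2 _ _ _ _] := D2.
apply: (measurable_fun_cvg (h := fun n x => F (s1 n x) (s2 n x))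
  (f := fun x => F (phi1 x) (phi2 x))) => //.
by move=> n; exact: simple2_measurable_fun.
Qed.

Let null_of B : measurable B -> (0 < M B -> False) -> m B = 0%E.
Proof.
move=> mB H; rewrite -(fineK (mE_fin mB)); congr EFin; apply/eqP.
by rewrite eq_le fine_ge0// andbT leNgt; apply/negP.
Qed.

Lemma density1_norm_le1 (e : R) : 0 < e ->
  m.-negligible (~` N `&` [set x | 1 + e < `|phi1 x|]).
Proof.
move=> e0; set B := (_ `&` _).
have mB : measurable B.
  apply: (measurable_nonnull (F := fun v _ => `|v|) (Y := [set z | 1 + e < z])).
    by rewrite -set_itvoy; exact: measurable_itv.
  move=> x Nx; apply: cvg_norm; have [_ _ _ + _] := D1; apply.
  by move=> N1x; apply: Nx; left.
exists B; split => //; apply: null_of => // B0.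
have r0 : 0 < e / 4 by rewrite divr_gt0.
have [E [v [w [mE EB E0 Evw]]]] := densities_near_constant mB B0 r0.
have [_ _ _ _ /(_ E v _ mE (ltW r0))] := D1.
move=> /(_ (fun x Ex => (Evw x Ex).1)) /(near_le1 mE E0 (mum1 mE)) v1.
have [x Ex] := exists_pt E0; have [_ /=] := EB _ Ex.
have := (Evw x Ex).1; have := ler_normD (phi1 x - v) v; rewrite subrK; lra.
Qed.

(** On a non-null set where the sum of the densities is shorter than [2 - e] and
    both are nearly constant, the variation of [mu1 + mu2] falls short of
    [2 * m E]; it cannot be made up for on the complement. *)
Lemma density_sum_norm_ge2 (e : R) : (2%:E * m setT <=
    vvariation (mu1 \+ mu2)%R setT)%E -> 0 < e ->
  m.-negligible (~` N `&` [set x | `|phi1 x + phi2 x| < 2 - e]).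
Proof.
move=> mu12 e0; set B := (_ `&` _).
have mB : measurable B.
  apply: (measurable_nonnull (F := fun v w => `|v + w|) (Y := [set z | z < 2 - e])).
    by rewrite -set_itvNyo; exact: measurable_itv.
  move=> x Nx; apply: cvg_norm; apply: cvgD.
    by have [_ _ _ + _] := D1; apply=> N1x; apply: Nx; left.
  by have [_ _ _ + _] := D2; apply=> N2x; apply: Nx; right.
exists B; split => //; apply: null_of => // B0.
have r0 : 0 < e / 8 by rewrite divr_gt0.
have [E [v [w [mE EB E0 Evw]]]] := densities_near_constant mB B0 r0.
pose C := 2 - e / 2.
have [x Ex] := exists_pt E0; have [_ /=] := EB _ Ex => Bx.
have vw : `|v + w| <= 2 - e + 2 * (e / 8).
  have [H1 H2] := Evw x Ex.
  have -> : v + w = (phi1 x + phi2 x) - ((phi1 x - v) + (phi2 x - w)).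
    by rewrite [X in _ - X]addrACA -opprD opprB [RHS]addrC subrK.
  have := ler_normB (phi1 x + phi2 x) ((phi1 x - v) + (phi2 x - w)).
  have := ler_normD (phi1 x - v) (phi2 x - w); lra.
have amu12 : finitely_additive (mu1 \+ mu2)%R.
  by move=> A B' mA mB' AB; rewrite /= amu1// amu2// addrACA.
have VE : (vvariation (mu1 \+ mu2)%R E <= C%:E * m E)%E.
  apply: vvariation_le => // F mF FE.
  have [_ _ _ _ /(_ F v _ mF (ltW r0))] := D1.
  move=> /(_ (fun x Fx => (Evw x (FE _ Fx)).1)) H1.
  have [_ _ _ _ /(_ F w _ mF (ltW r0))] := D2.
  move=> /(_ (fun x Fx => (Evw x (FE _ Fx)).2)) H2.
  have -> : (mu1 \+ mu2)%R F = M F *: (v + w) +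
      ((mu1 F - M F *: v) + (mu2 F - M F *: w)).
    by rewrite /= [X in _ = _ + X]addrACA -opprD -scalerDr [RHS]addrC subrK.
  have H3 : `|M F *: (v + w)| <= M F * (2 - e + 2 * (e / 8)).
    by rewrite normrZ ger0_norm ?fine_ge0// ler_wpM2l ?fine_ge0.
  have := ler_normD (M F *: (v + w)) ((mu1 F - M F *: v) + (mu2 F - M F *: w)).
  have := ler_normD (mu1 F - M F *: v) (mu2 F - M F *: w).
  have : 0 <= M F by rewrite fine_ge0.
  rewrite /C; nra.
have VCE : (vvariation (mu1 \+ mu2)%R (~` E) <= 2%:E * m (~` E))%E.
  apply: vvariation_le => //; first exact: measurableC.
  move=> F mF _ /=; have := ler_normD (mu1 F) (mu2 F).
  have := mum1 mF; have := mum2 mF; lra.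
have := le_trans mu12 (le_trans (vvariation_setT_le amu12 mE) (leeD VE VCE)).
have mCE : measurable (~` E) by exact: measurableC.
rewrite -(fineK (mE_fin measurableT)) -(fineK (mE_fin mE)) -(fineK (mE_fin mCE)).
rewrite -!EFinM -EFinD lee_fin.
have := fine_measureID m_fin measurableT mE; rewrite setTI setTD => ->.
by rewrite /C; nra.
Qed.

End EqualMeasures.

Section Uniqueness.
Context {R : realType} {X : normedModType R} {d : measure_display}
  {T : measurableType d}.
Variable m : {measure set T -> \bar R}.
Hypothesis m_fin : (m setT < +oo)%E.
Variables mu1 mu2 : set T -> X.
Hypothesis (vmu1 : vector_measure mu1) (vmu2 : vector_measure mu2).
Hypothesis (mum1 : forall E, measurable E -> `|mu1 E| <= fine (m E)).
Hypothesis (mum2 : forall E, measurable E -> `|mu2 E| <= fine (m E)).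

Local Notation M E := (fine (m E)).

Let mE_fin := measure_lty_fin_num m_fin.

Lemma strictly_convex_eq (u v : X) : strictly_convex X ->
  `|u| <= 1 -> `|v| <= 1 -> 2 <= `|u + v| -> u = v.
Proof.
move=> scX u1 v1 uv; have uvD := ler_normD u v.
apply: contrapT => neq; have := scX u v; have -> : `|u| = 1 by lra.
have -> : `|v| = 1 by lra.
by move=> /(_ erefl erefl neq); lra.
Qed.

Lemma densities_eq phi1 phi2 s1 s2 N1 N2 : strictly_convex X ->
  is_density m mu1 phi1 s1 N1 -> is_density m mu2 phi2 s2 N2 ->
  (2%:E * m setT <= vvariation (mu1 \+ mu2)%R setT)%E ->
  m.-negligible [set x | phi1 x <> phi2 x].
Proof.
move=> scX D1 D2 mu12.
have amu1 := vector_measure_additive vmu1.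
have amu2 := vector_measure_additive vmu2.
have k0 k : 0 < (k.+1%:R : R)^-1 by rewrite invr_gt0 ltr0n.
have nN1 : m.-negligible N1 by case: D1 => _ mN N0 _ _; exists N1; split.
have nN2 : m.-negligible N2 by case: D2 => _ mN N0 _ _; exists N2; split.
have nU1 := negligible_bigcup (fun k => density1_norm_le1 m_fin D1 D2 mum1 (k0 k)).
have nU2 := negligible_bigcup (fun k => density1_norm_le1 m_fin D2 D1 mum2 (k0 k)).
have nU12 := negligible_bigcup (fun k =>
  density_sum_norm_ge2 m_fin D1 D2 amu1 amu2 mum1 mum2 mu12 (k0 k)).
apply: negligibleS (negligibleU (negligibleU nN1 nN2)
  (negligibleU nU1 (negligibleU nU2 nU12))) => x /= neq.
apply: contrapT => H.
have N12 : ~ (N1 `|` N2) x by move=> ?; apply: H; left.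
have N21 : ~ (N2 `|` N1) x by rewrite setUC.
have lim_le (a b : R) : (forall k, a <= b + k.+1%:R^-1) -> a <= b.
  move=> ab; rewrite leNgt; apply/negP => /ltr_add_invr[k].
  by apply/negP; rewrite -leNgt.
apply/neq/strictly_convex_eq => //; apply: lim_le => k.
- rewrite leNgt; apply/negP => ?; apply: H; right; left; exists k => //.
- rewrite leNgt; apply/negP => ?; apply: H; right; right; left; exists k => //.
- rewrite -lerBlDr leNgt; apply/negP => ?; apply: H.
  by right; right; right; exists k.
Qed.

Theorem equal_vector_measures : strictly_convex X ->
  radon_nikodym_property X ->
  (2%:E * m setT <= vvariation (mu1 \+ mu2)%R setT)%E ->
  forall E, measurable E -> mu1 E = mu2 E.
Proof.
move=> scX rnp mu12 E mE.
have amu1 := vector_measure_additive vmu1.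
have amu2 := vector_measure_additive vmu2.
(* The variation of [mu1 + mu2] is at most the sum of the variations, each of which
   is at most [m]; hence both are equal to [m] on the whole space. *)
have [v1 v2] : (m setT <= vvariation mu1 setT)%E /\
    (m setT <= vvariation mu2 setT)%E.
  suff H (nu1 nu2 : set T -> X) : (forall E, measurable E -> `|nu1 E| <= M E) ->
      (forall E, measurable E -> `|nu2 E| <= M E) ->
      (2%:E * m setT <= vvariation (nu1 \+ nu2)%R setT)%E ->
      (m setT <= vvariation nu1 setT)%E.
    split; first exact: (H mu1 mu2).
    by apply: (H mu2 mu1) => //; rewrite (_ : (_ \+ _)%R = (mu1 \+ mu2)%R)//;
      apply/funext => F /=; rewrite addrC.
  move=> nu1m nu2m nu12.
  have : (vvariation (nu1 \+ nu2)%R setT <= vvariation nu1 setT + m setT)%E.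
    apply: ge_ereal_sup => _ [n [F [mF tF UF ->]]].
    apply: (@le_trans _ _ ((\sum_(i < n) `|nu1 (F i)|)%:E +
       (\sum_(i < n) `|nu2 (F i)|)%:E))%E.
      rewrite -EFinD lee_fin -big_split/=; apply: ler_sum => i _.
      exact: ler_normD.
    apply: leeD; first by apply: ereal_sup_ubound; exists n, F.
    apply: le_trans (_ : _ <= vvariation nu2 setT)%E _.
      by apply: ereal_sup_ubound; exists n, F.
    rewrite -[leRHS]mul1e; apply: vvariation_le => // F' mF' _.
    by rewrite mul1r nu2m.
  move/(le_trans nu12).
  have -> : (2%:E * m setT = m setT + m setT)%E.
    rewrite -(fineK (mE_fin measurableT)) -EFinM -EFinD; congr EFin.
    by rewrite mulr_natl mulr2n.
  by rewrite leeD2rE// mE_fin.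
have [phi1 [s1 [N1 D1]]] := rnp_density m_fin rnp vmu1 mum1 v1.
have [phi2 [s2 [N2 D2]]] := rnp_density m_fin rnp vmu2 mum2 v2.
have [Z [mZ Z0 phi12]] := densities_eq scX D1 D2 mu12.
have phiE x : ~ Z x -> phi2 x = phi1 x.
  by move=> Zx; apply: contrapT => neq; apply/Zx/phi12 => e; apply: neq.
apply/eqP; rewrite -subr_eq0 -normr_eq0 eq_le normr_ge0 andbT.
have MT0 : 0 <= M setT by rewrite fine_ge0.
suff H e : 0 < e -> `|mu1 E - mu2 E| <= e * (2 * M setT + 2).
  apply/ler_addgt0Pr => e e0; rewrite add0r.
  have c0 : 0 < 2 * M setT + 2 by lra.
  by rewrite -(divfK (lt0r_neq0 c0) e) H// divr_gt0.
move=> e0.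
(* On the set [D], which is [E] up to a set of measure at most [e], both measures are
   compared with the simple function [t] on each of its level sets. *)
have [A [t [mA st Ae At]]] := density_near_simple m_fin D1 e0 e0.
have mAZ : measurable (A `\` Z) by exact: measurableD.
pose D := E `&` (A `\` Z).
have mD : measurable D by exact: measurableI.
have mED : measurable (E `\` (A `\` Z)) by exact: measurableD.
have MED : M (E `\` (A `\` Z)) <= e.
  have mCA : measurable (~` A) by exact: measurableC.
  apply: le_trans (ltW Ae).
  have -> : M (~` A) = M (~` A) + M Z by rewrite Z0 addr0.
  rewrite -fineD ?mE_fin//; apply: fine_le; rewrite ?fin_numD ?mE_fin//.
  apply: le_trans (measureU2 _ _ _) => //; apply: le_measure; rewrite ?inE//.
    exact: measurableU.
  move=> x [Ex AZ]; have [Ax|] := pselect (A x); last by left.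
  by right; apply: contrapT => Zx; apply: AZ.
have MD : M D <= M setT.
  by apply: fine_le; rewrite ?mE_fin//; apply: le_measure; rewrite ?inE.
have HD : `|mu1 D - mu2 D| <= 2 * e * M D.
  rewrite (finitely_additive_simple amu1 st mD) (finitely_additive_simple amu2 st mD).
  have /= -> := finitely_additive_simple (finitely_additive_fine m_fin) st mD.
  rewrite -sumrB mulr_sumr; apply: le_trans (ler_norm_sum _ _ _) _.
  apply: ler_sum => v _; set F := D `&` _.
  have mF : measurable F by apply: measurableI => //; exact: st.2.
  have F1 x : F x -> `|phi1 x - v| <= e.
    by move=> [[_ [Ax _]] /= <-]; exact: At.
  have F2 x : F x -> `|phi2 x - v| <= e.
    by move=> Fx; rewrite phiE ?F1//; case: Fx => -[_ []].
  have [_ _ _ _ /(_ F v e mF (ltW e0) F1) H1] := D1.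
  have [_ _ _ _ /(_ F v e mF (ltW e0) F2) H2] := D2.
  rewrite -(subrK (M F *: v) (mu1 F)) -addrA.
  apply: le_trans (ler_normD _ _) _; rewrite (distrC (M F *: v)); lra.
rewrite (finitely_additiveID amu1 mAZ mE) (finitely_additiveID amu2 mAZ mE).
rewrite opprD addrACA; apply: le_trans (ler_normD _ _) _.
have := ler_normB (mu1 (E `\` (A `\` Z))) (mu2 (E `\` (A `\` Z))).
have := mum1 mED; have := mum2 mED.
rewrite -/D; move: HD MED MD MT0; nra.
Qed.

End Uniqueness.

(** * Limits of dominated vector measures *)

Section DominatedMeasures.
Context {R : realType} {X : completeNormedModType R} {d : measure_display}
  {T : measurableType d}.
Variable m : {measure set T -> \bar R}.
Hypothesis m_fin : (m setT < +oo)%E.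

Local Notation M E := (fine (m E)).

Let mE_fin := measure_lty_fin_num m_fin.

Lemma finitely_additive_sum (V : zmodType) (mu : set T -> V)
    (F : nat -> set T) n : finitely_additive mu ->
  (forall i, measurable (F i)) -> trivIset setT F ->
  mu (\big[setU/set0]_(i < n) F i) = \sum_(0 <= i < n) mu (F i).
Proof.
move=> amu mF tF; elim: n => [|n IH].
  by rewrite big_ord0 big_nil finitely_additive0.
rewrite big_ord_recr big_nat_recr//= amu ?IH//; first exact: bigsetU_measurable.
rewrite -bigcup_mkord; apply/seteqP; split => x // [[i /= ni Fix] Fnx].
move/trivIsetP : tF => /(_ i n Logic.I Logic.I); rewrite ltn_eqF// => /(_ isT).
by move=> /seteqP[/(_ x) + _]; apply; split.
Qed.

Lemma sum_measureI_le (E : set T) (F : nat -> set T) n : measurable E ->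
  (forall i, measurable (F i)) -> trivIset setT F ->
  \sum_(0 <= i < n) M (E `&` F i) <= M E.
Proof.
move=> mE mF tF; have mI i : measurable (E `&` F i) by exact: measurableI.
have tI : trivIset setT (fun i => E `&` F i) by exact: trivIset_setIl.
have /= <- := finitely_additive_sum n (finitely_additive_fine m_fin) mI tI.
have mU : measurable (\big[setU/set0]_(i < n) (E `&` F i)).
  exact: bigsetU_measurable.
apply: fine_le; rewrite ?mE_fin//; apply: le_measure; rewrite ?inE//.
by rewrite -(bigcup_mkord n (fun i => E `&` F i)) => x [i _ []].
Qed.

Lemma tail_small (F : nat -> set T) : (forall i, measurable (F i)) ->
  forall e : R, 0 < e -> \forall n \near \oo,
    M (\bigcup_i F i `\` \big[setU/set0]_(i < n) F i) < e.
Proof.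
move=> mF e e0; pose U n := \big[setU/set0]_(i < n) F i.
have mU n : measurable (U n) by exact: bigsetU_measurable.
have UE : \bigcup_n U n = \bigcup_i F i.
  apply/seteqP; split => x [n _]; first by rewrite /U -bigcup_mkord => -[i _ ?]; exists i.
  by move=> Fx; exists n.+1 => //; rewrite /U -bigcup_mkord; exists n => //=.
have mUF : measurable (\bigcup_i F i) by exact: bigcup_measurable.
have : (m \o U) n @[n --> \oo] --> m (\bigcup_n U n).
  apply: nondecreasing_cvg_mu => //; first by rewrite UE.
  by move=> n p np; apply/subsetPset; exact: subset_bigsetU.
rewrite UE -(fineK (mE_fin mUF)) => /fine_cvgP[_] /cvgrPdist_lt/(_ e e0).
apply: filterS => n /=; apply: le_lt_trans.
have /= -> := finitely_additiveID (finitely_additive_fine m_fin) (mU n) mUF.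
rewrite setIidr; last exact: bigsetU_bigcup.
by rewrite addrAC subrr add0r ler_norm.
Qed.

Lemma dominated_vector_measure (mu : set T -> X) : finitely_additive mu ->
  (forall E, measurable E -> `|mu E| <= M E) -> vector_measure mu.
Proof.
move=> amu mum F mF tF; have mUF : measurable (\bigcup_i F i) by exact: bigcup_measurable.
apply/cvgrPdist_lt => e e0; near=> n.
rewrite -finitely_additive_sum//.
have mU : measurable (\big[setU/set0]_(i < n) F i) by exact: bigsetU_measurable.
rewrite (finitely_additiveID amu mU mUF) setIidr; last exact: bigsetU_bigcup.
rewrite addrAC subrr add0r; apply: le_lt_trans (mum _ _) _; first exact: measurableD.
by near: n; exact: tail_small.
Unshelve. all: by end_near. Qed.

Variable mun : nat -> set T -> X.
Hypothesis amun : forall n, finitely_additive (mun n).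
Hypothesis munm : forall n E, measurable E -> `|mun n E| <= M E.

(** Convergence on a generating pi-system extends to all measurable sets: for a
    disjoint union, the tails are uniformly small as they are dominated by [m]. *)
Lemma dominated_cvg (G : set (set T)) : @measurable _ T = <<s G >> ->
  setI_closed G -> cvg (mun n setT @[n --> \oo]) ->
  (forall E, G E -> cvg (mun n E @[n --> \oo])) ->
  forall E, measurable E -> cvg (mun n E @[n --> \oo]).
Proof.
move=> GE GI cT cG E; rewrite GE.
apply: (dynkin_induction (P := fun E => cvg (mun n E @[n --> \oo])) GE GI cT cG).
- move=> S mS cS; have -> : (fun n => mun n (~` S)) = (fun n => mun n setT - mun n S).
    apply/funext => n.
    by rewrite (finitely_additiveID (@amun n) mS measurableT) setTI setTD addrAC subrr add0r.
  exact: is_cvgB.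
- move=> F mF tF cF; have mUF : measurable (\bigcup_i F i) by exact: bigcup_measurable.
  apply/cauchy_cvgP/cauchy_exP => e e0; have e2 : 0 < e / 2 by rewrite divr_gt0.
  have [N _ /(_ N (leqnn N)) /= HN] := tail_small mF e2.
  set U := \big[setU/set0]_(i < N) F i in HN.
  have mU : measurable U by exact: bigsetU_measurable.
  have cU : cvg (mun n U @[n --> \oo]).
    rewrite (_ : (fun n => _) = (fun n => \sum_(0 <= i < N) mun n (F i))).
      elim: N {HN U mU} => [|N IH].
        by under eq_fun do rewrite big_nil; exact: is_cvg_cst.
      by under eq_fun do rewrite big_nat_recr//=; exact: is_cvgD.
    by apply/funext => n; rewrite /U finitely_additive_sum.
  exists (lim (mun n U @[n --> \oo])).
  move/cvgrPdist_lt : cU => /(_ _ e2) [p _ Hp]; exists p => // n pn.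
  rewrite /= -ball_normE /=.
  apply: (@le_lt_trans _ _ (`|lim (mun n U @[n --> \oo]) - mun n U| +
      `|mun n (\bigcup_i F i `\` U)|)).
    rewrite (finitely_additiveID (@amun n) mU mUF) setIidr; last exact: bigsetU_bigcup.
    by rewrite opprD addrA ler_normB.
  have := Hp n pn => /=; have := munm n (measurableD mUF mU); lra.
Qed.

(** Setwise limit of the [mun n]; only meaningful on measurable sets. *)
Definition lim_measure E := lim (mun n E @[n --> \oo]).

Hypothesis munc : forall E, measurable E -> cvg (mun n E @[n --> \oo]).

Lemma lim_measure_additive : finitely_additive lim_measure.
Proof.
move=> A B mA mB AB; apply: cvg_lim => //.
rewrite (_ : (fun n => _) = (fun n => mun n A + mun n B)).
  by apply: cvgD; exact: munc.
by apply/funext => n; exact: amun.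
Qed.

Lemma lim_measure_le E : measurable E -> `|lim_measure E| <= M E.
Proof.
move=> mE; have H := cvg_norm (munc mE); apply: (cvgr_to_le (H _)).
by near=> n; exact: munm.
Unshelve. all: by end_near. Qed.

End DominatedMeasures.

(** * The vector measure of a Lipschitz path *)

Section LipschitzPath.
Context {R : realType} {X : completeNormedModType R}.
Variables (l : R) (l0 : 0 < l) (h : R -> X).
Hypothesis h_lip : forall a b, 0 <= a -> a <= b -> b <= l -> `|h b - h a| <= b - a.

(** The Lebesgue measure on ]0, l], as a finite measure on the real line. *)
Definition itv_measure := mrestr (@lebesgue_measure R) (measurable_itv `]0, l]).
HB.instance Definition _ := Measure.on itv_measure.

Local Notation T := (measurableTypeR R).
Local Notation M E := (fine (itv_measure E)).

Lemma itv_measureT : itv_measure setT = l%:E.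
Proof.
by rewrite /itv_measure /mrestr setTI lebesgue_measure_itv/= lte_fin l0 oppr0 adde0.
Qed.

Lemma itv_measure_fin : (itv_measure setT < +oo)%E.
Proof. by rewrite itv_measureT ltry. Qed.

Let mE_fin := measure_lty_fin_num itv_measure_fin.

Let M_additive := finitely_additive_fine itv_measure_fin.

Lemma itv_measure_oc (E : set R) (a b : R) : 0 <= a -> a <= b -> b <= l ->
  E `&` `]0, l]%classic = `]a, b]%classic -> M E = b - a.
Proof.
move=> a0 ab bl E_ab.
rewrite /itv_measure /mrestr E_ab lebesgue_measure_itv/= lte_fin.
by case: ltgtP ab => // -> _; rewrite subrr.
Qed.

(* The interval is cut into [n.+1] cells of length [step n]; [approx n E] is the
   integral over [E] of the function equal on each cell to the difference quotient
   of [h]. *)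
Let step n : R := l / n.+1%:R.
Let cell n k : set R := `]k%:R * step n, k.+1%:R * step n]%classic.
Let incr n k : X := h (k.+1%:R * step n) - h (k%:R * step n).
Let approx n (E : set T) : X :=
  \sum_(0 <= k < n.+1) (M (E `&` cell n k) / step n) *: incr n k.

Let step_gt0 n : 0 < step n.
Proof. by rewrite divr_gt0// ltr0n. Qed.

Let step_ge0 n : 0 <= step n.
Proof. exact: ltW. Qed.

Let node_ge0 n k : 0 <= k%:R * step n.
Proof. by rewrite mulr_ge0// ltW. Qed.

Let node_succ n k : k.+1%:R * step n = k%:R * step n + step n.
Proof. by rewrite -natr1 mulrDl mul1r. Qed.

Let node_le n k : (k <= n.+1)%N -> k%:R * step n <= l.
Proof.
move=> kn; rewrite /step mulrA ler_pdivrMr ?ltr0n// mulrC ler_wpM2l ?ler_nat//.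
exact: ltW.
Qed.

Let node_last n : n.+1%:R * step n = l.
Proof. by rewrite /step mulrC divfK// pnatr_eq0. Qed.

Let node_mono n j k : (j <= k)%N -> j%:R * step n <= k%:R * step n.
Proof. by move=> jk; rewrite ler_pM2r// ler_nat. Qed.

Let incr_le n k : (k <= n)%N -> `|incr n k| <= step n.
Proof.
move=> kn; apply: le_trans (h_lip _ _ _) _ => //.
- exact: node_mono.
- exact: node_le.
- by rewrite node_succ addrAC subrr add0r.
Qed.

Let coef_ge0 n (A : set T) : 0 <= M A / step n.
Proof. by apply: divr_ge0 => //; exact: fine_ge0. Qed.

Let cell_sub n k (x : R) : (k <= n)%N -> cell n k x -> 0 < x <= l.
Proof.
rewrite /cell/= => kn; rewrite in_itv/= => /andP[kx xk].
by rewrite (le_lt_trans (node_ge0 n k) kx) (le_trans xk (@node_le n k.+1 _)).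
Qed.

Let mcell n k : measurable (cell n k : set T).
Proof. exact: measurable_itv. Qed.

Let cell_trivIset n : trivIset setT (cell n).
Proof.
have H i j x : (i < j)%N -> cell n i x -> cell n j x -> False.
  rewrite /cell/= => ij; rewrite !in_itv/= => /andP[_ xi] /andP[jx _].
  by have := lt_le_trans jx (le_trans xi (node_mono n ij)); rewrite ltxx.
apply/trivIsetP => i j _ _; rewrite neq_ltn => /orP[] ij;
  apply/seteqP; split => // x [xi xj]; [exact: (H i j x)|exact: (H j i x)].
Qed.

Let approx_additive n : finitely_additive (approx n).
Proof.
move=> A B mA mB AB; rewrite -big_split/=; apply: eq_bigr => k _.
rewrite -scalerDl -mulrDl setIUl.
have /= -> // := M_additive (measurableI _ _ mA (mcell n k)) (measurableI _ _ mB (mcell n k)).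
by rewrite setIACA AB set0I.
Qed.

Let approx_le n (E : set T) : measurable E -> `|approx n E| <= M E.
Proof.
move=> mE; apply: le_trans (ler_norm_sum _ _ _) _.
apply: (@le_trans _ _ (\sum_(0 <= k < n.+1) M (E `&` cell n k))).
  rewrite !big_nat; apply: ler_sum => k /andP[_ kn].
  rewrite normrZ ger0_norm ?coef_ge0//.
  by rewrite mulrAC ler_pdivrMr// ler_wpM2l ?fine_ge0// incr_le.
exact: (sum_measureI_le itv_measure_fin n.+1 mE (mcell n) (@cell_trivIset n)).
Qed.

Let approx_ray_le n (E : set T) (b : R) : measurable E -> 0 <= b -> b <= l ->
  E `&` `]0, l]%classic = `]b, l]%classic ->
  `|approx n E - (h l - h b)| <= 2 * step n.
Proof.
move=> mE b0 bl Eb.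
have cellE k : (k <= n)%N -> (E `&` cell n k) `&` `]0, l]%classic =
    `]b, l]%classic `&` cell n k.
  by move=> kn; rewrite setIAC Eb.
have M0 k : (k <= n)%N -> k.+1%:R * step n <= b -> M (E `&` cell n k) = 0.
  move=> kn kb; rewrite (@itv_measure_oc _ 0 0) ?subrr ?(ltW l0)// cellE//.
  rewrite /cell; apply/seteqP; split => x /=; rewrite !in_itv/=; last by lra.
  by move=> [/andP[bx _] /andP[_ xk]]; lra.
have M1 k : (k <= n)%N -> b <= k%:R * step n -> M (E `&` cell n k) = step n.
  move=> kn kb; rewrite (@itv_measure_oc _ (k%:R * step n) (k.+1%:R * step n)).
  - by rewrite node_succ addrAC subrr add0r.
  - exact: node_ge0.
  - exact: node_mono.
  - exact: node_le.
  rewrite cellE// /cell; apply/seteqP; split => x /=; rewrite !in_itv/=; first by case.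
  have := @node_le n k.+1 kn => H /andP[kx xk]; rewrite kx xk; split => //.
  by rewrite (le_lt_trans kb kx) (le_trans xk H).
have M2 k : (k <= n)%N -> M (E `&` cell n k) <= step n.
  move=> kn; have -> : step n = M (cell n k).
    rewrite (@itv_measure_oc _ (k%:R * step n) (k.+1%:R * step n)).
    - by rewrite node_succ addrAC subrr add0r.
    - exact: node_ge0.
    - exact: node_mono.
    - exact: node_le.
    by rewrite setIidl// => x /(cell_sub kn); rewrite /= in_itv.
  apply: fine_le; rewrite ?mE_fin//; first exact: measurableI.
  by apply: le_measure; rewrite ?inE//; exact: measurableI.
pose S p := \sum_(0 <= k < p) (M (E `&` cell n k) / step n) *: incr n k.
(* Sums over the first [p] cells: those before [b] contribute nothing, the one
   containing [b] an error, and the following ones telescope. *)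
have HS p : (p <= n.+1)%N -> (p%:R * step n <= b -> S p = 0) /\
    (b < p%:R * step n -> `|S p - (h (p%:R * step n) - h b)| <= 2 * step n).
  elim: p => [_|p IH pn].
    by rewrite /S big_nil mul0r; split => // /(le_lt_trans b0); rewrite ltxx.
  have [IH1 IH2] := IH (ltnW pn).
  have SS : S p.+1 = S p + (M (E `&` cell n p) / step n) *: incr n p.
    by rewrite /S big_nat_recr.
  split => pb.
    by rewrite SS IH1 ?M0 ?mul0r ?scale0r ?addr0// (le_trans _ pb)// node_mono.
  have [bp|bp] := leP (p%:R * step n) b; last first.
    rewrite SS (M1 _ pn (ltW bp)) divff ?lt0r_neq0// scale1r /incr.
    set u := h (p.+1%:R * _); set v := h (p%:R * _).
    have -> : S p + (u - v) - (u - h b) = S p - (v - h b).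
      by rewrite !opprB -!addrA; congr +%R; rewrite addrCA [RHS]addrC;
         congr +%R; rewrite addrCA subrr addr0.
    exact: IH2.
  rewrite SS IH1// add0r; apply: le_trans (ler_normB _ _) _.
  have -> : 2 * step n = step n + step n by rewrite mulr_natl mulr2n.
  apply: lerD.
    rewrite normrZ ger0_norm ?coef_ge0//.
    apply: le_trans _ (@incr_le n p pn); rewrite ler_piMl// ler_pdivrMr// mul1r.
    exact: M2.
  apply: le_trans (h_lip b0 (ltW pb) (node_le pn)) _.
  by rewrite node_succ; lra.
have [HS1 HS2] := HS n.+1 (leqnn _); move: HS1 HS2.
rewrite node_last /S -/(approx n E) => HS1 HS2.
have [lb|] := leP l b; last exact: HS2.
have -> : b = l by apply/le_anti; rewrite lb bl.
by rewrite subrr subr0 HS1// normr0 mulr_ge0// ltW.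
Qed.

Let approx_ray (E : set T) (b : R) : measurable E -> 0 <= b -> b <= l ->
  E `&` `]0, l]%classic = `]b, l]%classic ->
  approx n E @[n --> \oo] --> h l - h b.
Proof.
move=> mE b0 bl Eb; apply/cvgrPdist_le => e e0.
have /cvgrPdist_le/(_ e e0) : (2 * step n @[n --> \oo] --> (0:R)).
  rewrite -(mulr0 2) -(mulr0 l); apply: cvgM; first exact: cvg_cst.
  by apply: cvgM; [exact: cvg_cst|exact: cvg_harmonic].
apply: filterS => n; rewrite sub0r normrN ger0_norm; last first.
  by rewrite mulr_ge0// ltW.
by rewrite distrC; apply: le_trans; exact: approx_ray_le.
Qed.

(* Up to the part outside ]0, l], every ray is one starting in [0, l]. *)
Let clampE (x : R) : exists2 b, 0 <= b <= l &
  `]x, +oo[%classic `&` `]0, l]%classic = `]b, l]%classic.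
Proof.
exists (Num.max 0 (Num.min x l)).
  by rewrite le_max lexx/= ge_max (ltW l0)/= ge_min lexx orbT.
apply/seteqP; split => y /=; rewrite !in_itv/= andbT gt_max gt_min.
  by move=> [-> /andP[-> ->]].
move=> /andP[/andP[y0 /orP[xy|ly]] yl]; first by rewrite xy y0 yl.
by move: ly; rewrite ltNge yl.
Qed.

(** A 1-Lipschitz path into a complete space is the primitive of a vector measure
    dominated by the Lebesgue measure. *)
Lemma lipschitz_measure : exists mu : set T -> X,
  [/\ vector_measure mu, forall E, measurable E -> `|mu E| <= M E &
    forall a b, 0 <= a -> a <= b -> b <= l -> mu `]a, b]%classic = h b - h a].
Proof.
have approxT : approx n setT @[n --> \oo] --> h l - h 0.
  by apply: approx_ray => //; [exact: ltW|rewrite setTI].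
have approxc E : measurable E -> cvg (approx n E @[n --> \oo]).
  apply: (dominated_cvg itv_measure_fin approx_additive approx_le
    (G := @RGenOInfty.G R)).
  - exact: RGenOInfty.measurableE.
  - move=> A B [x ->] [y ->]; exists (Num.max x y).
    by apply/seteqP; split => z /=; rewrite !in_itv/= !andbT gt_max => /andP.
  - by apply/cvg_ex; exists (h l - h 0).
  move=> _ [x ->]; have [b /andP[b0 bl] Eb] := clampE x.
  by apply/cvg_ex; exists (h l - h b); apply: approx_ray => //; exact: measurable_itv.
pose mu := lim_measure approx.
have amu : finitely_additive mu by exact: lim_measure_additive.
have mum E : measurable E -> `|mu E| <= M E by exact: lim_measure_le.
have ray b : 0 <= b -> b <= l -> mu `]b, +oo[%classic = h l - h b.
  move=> b0 bl; apply: cvg_lim => //; apply: approx_ray => //.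
  apply/seteqP; split => y /=; rewrite !in_itv/= andbT; first by case=> -> /andP[].
  by move=> /andP[yb yl]; rewrite yb yl (le_lt_trans b0 yb).
exists mu; split => //; first exact: (dominated_vector_measure itv_measure_fin amu mum).
move=> a b a0 ab bl.
have := amu `]a, b]%classic `]b, +oo[%classic (measurable_itv _) (measurable_itv _).
have -> : `]a, b]%classic `&` `]b, +oo[%classic = set0 :> set R.
  by apply/seteqP; split => y //=; rewrite !in_itv/= andbT => -[/andP[_ yb]]; lra.
have -> : `]a, b]%classic `|` `]b, +oo[%classic = `]a, +oo[%classic :> set R.
  apply/seteqP; split => y /=; rewrite !in_itv/= !andbT; first by lra.
  by move=> ay; have [yb|yb] := leP y b; [left; rewrite ay|right].
rewrite !ray ?(le_trans a0)// ?(le_trans ab)// => /(_ erefl) hE.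
by apply: (addIr (h l - h b)); rewrite -hE [RHS]addrC addrA subrK.
Qed.

End LipschitzPath.

(** * Lipschitz paths whose sum has full length *)

Section FullLength.
Context {R : realType} {X : completeNormedModType R}.
Implicit Types (h : R -> X) (s : seq R).

Lemma path_variation_le_vvariation (mu : set (measurableTypeR R) -> X) h
    (a b : R) s : itv_partition a b s ->
  (forall u v, a <= u -> u <= v -> v <= b -> mu `]u, v]%classic = h v - h u) ->
  ((path_variation a b h s)%:E <= vvariation mu setT)%E.
Proof.
move=> abs mu_h; pose x := nth b (a :: s); pose n := size s.
have x_le i j : (i <= j <= n)%N -> x i <= x j.
  move=> /andP[ij jn]; have [sa _] := abs.
  move: ij; rewrite leq_eqVlt => /predU1P[->//|ij].
  by apply/ltW/(sorted_ltn_nth lt_trans) => //; rewrite inE/= ltnS// ltnW// (leq_trans ij).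
have ax i : (i <= n)%N -> a <= x i by move=> ni; exact: itv_partition_nth_ge abs.
have xb i : (i <= n)%N -> x i <= b by move=> ni; exact: itv_partition_nth_le abs.
pose I i : set (measurableTypeR R) := `]x i, x i.+1]%classic.
have mI i : measurable (I i) by exact: measurable_itv.
have disj i j : (i < j < n)%N -> I i `&` I j = set0.
  move=> /andP[ij jn]; rewrite /I; apply/seteqP; split => // z /=.
  rewrite !in_itv/= => -[/andP[_ zi] /andP[jz _]].
  have := x_le i.+1 j; rewrite ij ltnW// => /(_ isT); lra.
(* The intervals of the partition and the complement of their union. *)
pose F i := if (i < n)%N then I i else ~` (\big[setU/set0]_(j < n) I j).
have mF i : measurable (F i).
  by rewrite /F; case: ifP => // _; apply: measurableC; exact: bigsetU_measurable.
apply: (@le_trans _ _ (\sum_(i < n.+1) `|mu (F i)|)%:E).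
  rewrite lee_fin big_ord_recr/= ler_wpDr// /path_variation big_mkord.
  rewrite le_eqVlt; apply/orP; left; apply/eqP/eq_bigr => i _ /=.
  have iin : (i.+1 <= n)%N by exact: ltn_ord.
  rewrite /F iin /I mu_h//.
  - exact: (ax i (ltnW iin)).
  - by apply: x_le; rewrite leqnSn iin.
  - exact: (xb i.+1 iin).
apply: ereal_sup_ubound; exists n.+1, F; split => //.
  apply/trivIsetP => i j /=; rewrite !ltnS.
  wlog ij : i j / (i < j)%N => [H ni nj|].
    by rewrite neq_ltn => /orP[] ij; [|rewrite setIC]; apply: H => //; rewrite ltn_eqF.
  move=> ni nj _; rewrite /F (leq_trans ij nj).
  case: ifPn => jn; first by apply: disj; rewrite ij.
  apply/seteqP; split => // z [Iz]; apply.
  by rewrite -bigcup_mkord; exists i => //=; exact: leq_trans ij nj.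
apply/seteqP; split => // z _.
have [|nz] := pselect ((\big[setU/set0]_(j < n) I j) z).
  rewrite -bigcup_mkord => -[i /= ni Iz]; exists i => //=; first by rewrite ltnW.
  by rewrite /F ni.
by exists n => //=; rewrite /F ltnn.
Qed.

(** Two 1-Lipschitz curves whose sum has full length differ by a constant. *)
Theorem full_length_sum_eq (l : R) h1 h2 : strictly_convex X ->
  radon_nikodym_property X -> 0 <= l ->
  (forall a b, 0 <= a -> a <= b -> b <= l -> `|h1 b - h1 a| <= b - a) ->
  (forall a b, 0 <= a -> a <= b -> b <= l -> `|h2 b - h2 a| <= b - a) ->
  ((2 * l)%:E <= path_length 0 l (h1 \+ h2)%R)%E ->
  forall a, 0 <= a <= l -> h1 a - h1 0 = h2 a - h2 0.
Proof.
move=> scX rnp; rewrite le_eqVlt => /predU1P[<- _ _ _ a|l0 lip1 lip2 full a].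
  by move=> /le_anti <-; rewrite !subrr.
move=> /andP[a0 al].
have [mu1 [vmu1 mum1 mu1h]] := lipschitz_measure l0 lip1.
have [mu2 [vmu2 mum2 mu2h]] := lipschitz_measure l0 lip2.
rewrite -mu1h// -mu2h//.
apply: (equal_vector_measures (itv_measure_fin l0) vmu1 vmu2 mum1 mum2 scX rnp _
  (measurable_itv _)).
apply: (@le_trans _ _ (2 * l)%:E).
  by rewrite EFinM -(itv_measureT l0); exact: lexx.
apply: le_trans full _.
apply: ge_ereal_sup => _ [s sP <-]; apply: path_variation_le_vvariation => //.
by move=> u v u0 uv vl /=; rewrite mu1h// mu2h// addrACA -opprD.
Qed.

End FullLength.

(** * Uniqueness of quasihyperbolic geodesics *)

(** Two curves with the same length function, whose midpoint path has full
    length, coincide. *)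
Lemma eq_curves_full_length {R : realType} {X : completeNormedModType R}
    (g1 g2 : R -> X) (K : R) :
  strictly_convex X -> radon_nikodym_property X ->
  (path_length 0 1 g1 < +oo)%E -> (path_length 0 1 g2 < +oo)%E ->
  g1 0 = g2 0 ->
  (forall a b, 0 <= a -> a <= b -> b <= 1 ->
    arclength g1 b - arclength g1 a <= K * (b - a)) ->
  (forall t, 0 <= t <= 1 -> arclength g1 t = arclength g2 t) ->
  arclength g1 1 <= arclength (midpath g1 g2 id) 1 ->
  (path_length 0 1 (midpath g1 g2 id) < +oo)%E ->
  forall t, 0 <= t <= 1 -> g1 t = g2 t.
Proof.
move=> scX rnp fin1 fin2 g0 lip S12 full c_fin t t01.
pose S := arclength g1; pose l := S 1.
have S_le a b : 0 <= a -> a <= b -> b <= 1 -> S a <= S b by exact: (arclength_le fin1).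
have S0 : S 0 = 0 by exact: arclength0.
have S_cont : {within `[0, 1], continuous S}.
  apply: (@lipschitz_within_continuous _ R^o S K) => u v u0 uv v1.
  by rewrite ger0_norm ?subr_ge0 ?S_le//; exact: lip.
have l0 : 0 <= l by rewrite /l -S0 S_le.
have T_ex la : exists u, 0 <= la <= l -> 0 <= u <= 1 /\ S u = la.
  have [la01|] := pselect (0 <= la <= l); last by exists 0.
  have [|u u01 Su] := @IVT _ S 0 1 la ler01 S_cont.
    by rewrite S0 -/l (min_idPl l0) (max_idPr l0).
  by exists u => _; split => //; move: u01; rewrite in_itv.
(* [T la] is a time at which the common length is [la]; [h1] and [h2] below are the
   parametrizations by arc length. *)
pose T la := sval (cid (T_ex la)).
have TP la : 0 <= la <= l -> 0 <= T la <= 1 /\ S (T la) = la.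
  exact: (svalP (cid (T_ex la))).
have gS (g : R -> X) : (path_length 0 1 g < +oo)%E ->
    (forall t, 0 <= t <= 1 -> arclength g t = S t) ->
    forall u v, 0 <= u <= 1 -> 0 <= v <= 1 -> `|g v - g u| <= `|S v - S u|.
  move=> gfin gE u v; wlog uv : u v / u <= v => [H u01 v01|u01 v01].
    have [uv|/ltW vu] := leP u v; first exact: H.
    by rewrite distrC (distrC (S v)); exact: H.
  have /andP[u0 _] := u01; have /andP[_ v1] := v01.
  have := norm_le_arclength gfin u0 uv v1; rewrite !gE// => /le_trans; apply.
  exact: ler_norm.
have gS1 := gS g1 fin1 (fun t _ => erefl).
have gS2 := gS g2 fin2 (fun t t01 => esym (S12 t t01)).
have lipT (g : R -> X) : (forall u v, 0 <= u <= 1 -> 0 <= v <= 1 -> `|g v - g u| <= `|S v - S u|) ->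
    forall a b, 0 <= a -> a <= b -> b <= l -> `|g (T b) - g (T a)| <= b - a.
  move=> H a b a0 ab bl.
  have [Ta Sa] : 0 <= T a <= 1 /\ S (T a) = a by apply: TP; rewrite a0 (le_trans ab).
  have [Tb Sb] : 0 <= T b <= 1 /\ S (T b) = b by apply: TP; rewrite bl (le_trans a0).
  by apply: le_trans (H _ _ Ta Tb) _; rewrite Sa Sb ger0_norm// subr_ge0.
have gT (g : R -> X) : (forall u v, 0 <= u <= 1 -> 0 <= v <= 1 -> `|g v - g u| <= `|S v - S u|) ->
    forall u, 0 <= u <= 1 -> g (T (S u)) = g u.
  move=> H u u01; have /andP[u0 u1] := u01.
  have [Tu Su] : 0 <= T (S u) <= 1 /\ S (T (S u)) = S u.
    by apply: TP; rewrite -S0 !S_le.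
  apply/eqP; rewrite -subr_eq0 -normr_eq0 eq_le normr_ge0 andbT.
  by apply: le_trans (H _ _ u01 Tu) _; rewrite Su subrr normr0.
pose h1 := g1 \o T; pose h2 := g2 \o T.
have hl1 : forall a b, 0 <= a -> a <= b -> b <= l -> `|h1 b - h1 a| <= b - a by exact: lipT.
have hl2 : forall a b, 0 <= a -> a <= b -> b <= l -> `|h2 b - h2 a| <= b - a by exact: lipT.
pose h := (h1 \+ h2)%R.
have h_fin : (path_length 0 l h < +oo)%E.
  apply: le_lt_trans (ltry (2 * l - 2 * 0)).
  have := @path_length_le_majorant _ _ 0 l 0 h (fun a => 2 * a) (lexx 0) l0.
  rewrite path_lengthxx add0e; apply => u v u0 uv vl.
  rewrite /h/= opprD addrACA; apply: le_trans (ler_normD _ _) _.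
  by have := hl1 u v u0 uv vl; have := hl2 u v u0 uv vl; lra.
have full_h : ((2 * l)%:E <= path_length 0 l h)%E.
  (* The length of [h1 + h2], read at the arc length parameter, majorizes twice the
   increments of the midpoint path. *)
rewrite -(fineK (path_length_fin h_fin (t := l) _)) ?l0 ?lexx// lee_fin.
  have := @arclength_le_majorant _ _ 1 _ c_fin 0 1 (fun u => 2^-1 * arclength h (S u))
    (lexx 0) ler01 (lexx 1).
  rewrite S0 !arclength0 mulr0 !subr0 => H.
  suff : arclength (midpath g1 g2 id) 1 <= 2^-1 * arclength h l.
    by move: full; rewrite -/S -/l /arclength; lra.
  apply: H => u v u0 uv v1.
  have u01 : 0 <= u <= 1 by rewrite u0 (le_trans uv).
  have v01 : 0 <= v <= 1 by rewrite v1 (le_trans u0).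
  rewrite /midpath -scalerBr normrZ ger0_norm ?invr_ge0// -mulrBr ler_wpM2l ?invr_ge0//.
  have Su0 : 0 <= S u by rewrite -S0 S_le// (le_trans uv).
  have Suv : S u <= S v by exact: S_le.
  have Svl : S v <= l by apply: S_le => //; exact: le_trans u0 uv.
  have := norm_le_arclength h_fin Su0 Suv Svl.
  by rewrite /h /h1 /h2 /= (gT _ gS1 u u01) (gT _ gS1 v v01) (gT _ gS2 u u01) (gT _ gS2 v v01).
have /andP[t0 t1] := t01.
have St : 0 <= S t <= l by rewrite -S0 !S_le.
have := full_length_sum_eq scX rnp l0 hl1 hl2 full_h St.
have i0 : 0 <= (0 : R) <= 1 by rewrite lexx ler01.
have h10 : h1 0 = g1 0 by rewrite -[RHS](gT _ gS1 0 i0) S0.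
have h20 : h2 0 = g2 0 by rewrite -[RHS](gT _ gS2 0 i0) S0.
rewrite h10 h20 g0 => /addIr; rewrite /h1/h2/= (gT _ gS1)// (gT _ gS2)//.
Qed.

Theorem theorem2p1 (R : realType) (X : completeNormedModType R)
    (Omega : set X)
    (X_strictly_convex : strictly_convex X)
    (X_RNP : radon_nikodym_property X)
    (X_dim : dim_ge2 X)
    (Omega_nonempty : Omega !=set0)
    (Omega_proper : Omega <> setT)
    (Omega_open : open Omega)
    (Omega_convex : convex_set (Omega : set (convex_lmodType X)))
    (x y : X) (Omega_x : Omega x) (Omega_y : Omega y)
    (g1 g2 : R -> X)
    (g1_geodesic : qh_geodesic Omega x y g1)
    (g2_geodesic : qh_geodesic Omega x y g2)
    (g1_prop : qh_proportional Omega g1)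
    (g2_prop : qh_proportional Omega g2) :
  forall t : R, 0 <= t <= 1 -> g1 t = g2 t.
Proof.
have [g1P g1_min] := g1_geodesic; have [g2P g2_min] := g2_geodesic.
have i1 : 0 <= (1 : R) <= 1 by rewrite lexx ler01.
have QE g : rectifiable_path Omega x y g -> (qh_param Omega g 1)%:E = qh_length Omega 0 1 g.
  by move=> gP; exact: (qh_paramE Omega_proper Omega_open Omega_nonempty gP).
pose L := qh_param Omega g1 1.
have L2 : qh_param Omega g2 1 = L.
  by apply: EFin_inj; rewrite !QE// g1_min g2_min.
have L_min c : rectifiable_path Omega x y c -> L <= qh_param Omega c 1.
  move=> cP; rewrite -lee_fin !QE// g1_min.
  by apply: ereal_inf_lbound; exists c.
have [K1 speed1] := geodesic_metric_speed Omega_proper Omega_open Omega_nonempty g1P g1_prop.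
have [K2 speed2] := geodesic_metric_speed Omega_proper Omega_open Omega_nonempty g2P g2_prop.
pose K := Num.max K1 K2.
have ms1 : metric_speed Omega g1 L K by apply: speed1; rewrite le_max lexx.
have ms2 : metric_speed Omega g2 L K by rewrite -L2; apply: speed2; rewrite le_max lexx orbT.
have d12 t : 0 <= t <= 1 ->
    dist_set (g1 t) (boundary Omega) = dist_set (g2 t) (boundary Omega).
  move=> t01; apply/le_anti/andP; split.
    exact: (dist_geodesics_le Omega_proper Omega_open Omega_nonempty Omega_convex
      L_min g1P g2P ms1 ms2).
  exact: (dist_geodesics_le Omega_proper Omega_open Omega_nonempty Omega_convex
    L_min g2P g1P ms2 ms1).
have S12 t : 0 <= t <= 1 -> arclength g1 t = arclength g2 t.
  move=> t01; apply/le_anti/andP; split.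
    by apply: (arclength_le_of_dist ms1 ms2) => // s s01; rewrite d12.
  by apply: (arclength_le_of_dist ms2 ms1) => // s s01; rewrite d12.
have id_mono (a b : R) : 0 <= a -> a <= b -> b <= 1 -> 0 <= id b - id a <= 2 * (b - a).
  by move=> _ ab _ /=; lra.
have cP := midpath_rectifiable Omega_convex g1P g2P ms1 ms2 (erefl (id 0)) (erefl (id 1)) id_mono.
have full := midpath_geodesics_length Omega_proper Omega_open Omega_nonempty Omega_convex
  L_min g1P g2P ms1 ms2.
rewrite -S12// in full.
case: g1P => _ _ g10 _ fin1; case: g2P => _ _ g20 _ fin2; case: cP => _ _ _ _ c_fin.
have [_ _ lip _] := ms1.
apply: (eq_curves_full_length X_strictly_convex X_RNP fin1 fin2 _ lip S12 _ c_fin).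
  by rewrite g10 g20.
by move: full; lra.
Qed.
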